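(* Let $E$ be a Banach sequence lattice on a non-empty set $I$ with $C_E<\infty$. Let $(A_i)_{i\in I}$ be Banach algebras and let $A=\bigl(\bigoplus_{i\in I}A_i\bigr)_E$ be their $E$-sum. Then $A$ is weakly amenable if and only if $\sup_{i\in I}\mathrm{WAM}(A_i)<\infty$. Moreover, in that case $$C_E^{-1}\sup_{i\in I}\mathrm{WAM}(A_i)\ \le\ \mathrm{WAM}(A)\ \le\ C_E^2\,\sup_{i\in I}\mathrm{WAM}(A_i).$$ If, in particular, $\|\delta_i\|_E=1$ for all $i\in I$ (as for the usual $c_0(I)$ norm), then the lower bound improves to $\sup_i\mathrm{WAM}(A_i)\le\mathrm{WAM}(A)$. For an Orlicz heart $E=h_\varphi(I)$ with $a_\varphi:=\sup\{t\ge0:\varphi(t)=0\}>0$ (so that $C_E<\infty$), its Luxemburg norm being multiplied by a fixed positive scalar so that the inclusion into $\ell_\infty(I)$ is contractive, weak amenability of $\bigl(\bigoplus_{i\in I}A_i\bigr)_{h_\varphi(I)}$ is equivalent to uniform weak amenability of the summands, i.e. to $\sup_{i\in I}\mathrm{WAM}(A_i)<\infty$.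
   Context: All Banach spaces and algebras are complex. $c_{00}(I)$ denotes the finitely supported complex functions on $I$, $\chi_F$ the characteristic function of $F\subseteq I$, and $\delta_i=\chi_{\{i\}}$. $C_E:=\sup\{\|\chi_F\|_E: F\subseteq I\text{ finite}\}$. Weak amenability. For a Banach algebra $A$, $A^*$ is an $A$-bimodule via $(a\cdot\phi)(x)=\phi(xa)$, $(\phi\cdot a)(x)=\phi(ax)$. A bounded linear map $D\colon A\to A^*$ is a derivation if $D(ab)=a\cdot D(b)+D(a)\cdot b$ for all $a,b\in A$. For $\phi\in A^*$, $\mathrm{ad}_\phi(a):=a\cdot\phi-\phi\cdot a$ is the inner derivation implemented by $\phi$. $A$ is weakly amenable if every bounded derivation $A\to A^*$ is inner. The weak amenability constant $\mathrm{WAM}(A)\in[0,\infty]$ is the infimum of all $C\ge0$ such that for every bounded derivation $D\colon A\to A^*$ there is $\phi\in A^*$ with $D=\mathrm{ad}_\phi$ and $\|\phi\|\le C\|D\|$; $\mathrm{WAM}(A)=+\infty$ if $A$ is not weakly amenable. Banach sequence lattice. A Banach sequence lattice on $I$ is a Banach space $E$ of complex-valued functions on $I$ such that (a) $c_{00}(I)\subseteq E\subseteq\ell_\infty(I)$ and $c_{00}(I)$ is dense in $E$; (b) $E$ is solid: if $y\in E$, $x\in\ell_\infty(I)$ and $|x_i|\le|y_i|$ for all $i$, then $x\in E$ and $\|x\|_E\le\|y\|_E$; (c) $\|x\|_\infty\le\|x\|_E$ for all $x\in E$. $E$-sum. $\bigl(\bigoplus_{i\in I}A_i\bigr)_E$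 is the Banach algebra of all families $a=(a_i)_{i\in I}$, $a_i\in A_i$, with $(\|a_i\|)_{i\in I}\in E$, with norm $\|a\|=\|(\|a_i\|)_{i\in I}\|_E$ and coordinatewise multiplication. Orlicz heart. An Orlicz function is, as usual, a convex, continuous, non-decreasing $\varphi\colon[0,\infty)\to[0,\infty)$ with $\varphi(0)=0$ and $\varphi(t)\to\infty$ as $t\to\infty$. The Luxemburg norm is $\|x\|_\varphi=\inf\{\lambda>0:\sum_{i\in I}\varphi(|x_i|/\lambda)\le1\}$, and $h_\varphi(I)$ is the closure of $c_{00}(I)$ in $\{x\in\mathbb{C}^I:\|x\|_\varphi<\infty\}$. *)

(* Defs.v *)
From HB Require Import structures.
From mathcomp Require Import all_boot all_order all_algebra.
From mathcomp Require Import all_classical all_reals all_analysis.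
From mathcomp Require Import complex.

Set Implicit Arguments.
Unset Strict Implicit.
Unset Printing Implicit Defensive.

Import Order.TTheory GRing.Theory Num.Theory numFieldNormedType.Exports.

Local Open Scope classical_set_scope.
Local Open Scope complex_scope.
Local Open Scope ring_scope.

(* Over the field R[i], MathComp norms take their values in R[i]. *)
Definition rnorm (R : realType) (V : normedZmodType R[i]) (x : V) : R :=
  complex.Re `|x|.

Section rnorm_theory.
Context (R : realType) (V : normedZmodType R[i]).
Implicit Types x y : V.

Lemma rnormE x : (rnorm x)%:C = `|x|.
Proof. by rewrite /rnorm RRe_real// normr_real. Qed.

Lemma rnorm_ge0 x : 0 <= rnorm x.
Proof. by rewrite -lecR rnormE normr_ge0. Qed.

Lemma rnormD x y : rnorm (x + y) <= rnorm x + rnorm y.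
Proof. by rewrite -lecR rmorphD/= !rnormE ler_normD. Qed.

Lemma rnormN x : rnorm (- x) = rnorm x.
Proof. by rewrite /rnorm normrN. Qed.

Lemma rnorm0 : rnorm (0 : V) = 0.
Proof. by rewrite /rnorm normr0. Qed.

Lemma rnorm0_eq0 x : rnorm x = 0 -> x = 0.
Proof. by move=> x0; apply/normr0_eq0; rewrite -rnormE x0. Qed.

End rnorm_theory.

Lemma rnormZ (R : realType) (V : normedModType R[i]) (k : R[i]) (x : V) :
  rnorm (k *: x) = rnorm k * rnorm x.
Proof.
by apply: (@complexI R); rewrite rmorphM/= !rnormE normrZ.
Qed.

Lemma rnormM (R : realType) (k x : R[i]) : rnorm (k * x) = rnorm k * rnorm x.
Proof.
by apply: (@complexI R); rewrite rmorphM/= !rnormE normrM.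
Qed.

Lemma rnorm_real (R : realType) (k : R) : rnorm (k%:C) = `|k|.
Proof. by apply: (@complexI R); rewrite rnormE normc_def/= expr0n/= addr0 sqrtr_sqr. Qed.

Lemma rnorm_norm (R : realType) (V : normedZmodType R[i]) (x : V) :
  rnorm (`|x| : R[i]) = rnorm x.
Proof. by rewrite /rnorm normr_id. Qed.

Section bounded_operators.
Context (R : realType) (V W : normedModType R[i]).
Implicit Type f : V -> W.

Definition bounded_op f := exists M : R, forall x, rnorm (f x) <= M * rnorm x.

Definition opnorm f : R := sup [set rnorm (f x) | x in [set x | rnorm x <= 1]].

Lemma opnorm_has_sup f : bounded_op f ->
  has_sup [set rnorm (f x) | x in [set x | rnorm x <= 1]].
Proof.
move=> [M fM]; split.
  by exists (rnorm (f 0)), 0 => //=; rewrite rnorm0 ler01.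
exists `|M| => _ [x /= x1 <-]; rewrite (le_trans (fM x))//.
rewrite (le_trans (ler_wpM2r (rnorm_ge0 x) (ler_norm M)))//.
by rewrite ler_piMr.
Qed.

Lemma opnorm_ub f x : bounded_op f -> rnorm x <= 1 -> rnorm (f x) <= opnorm f.
Proof.
by move=> /opnorm_has_sup fs x1; apply: sup_upper_bound => //; exists x.
Qed.

Lemma opnorm_le f (M : R) : (forall x, rnorm x <= 1 -> rnorm (f x) <= M) ->
  opnorm f <= M.
Proof.
move=> fM; apply: ge_sup; last by move=> _ [x /= x1 <-]; exact: fM.
by exists (rnorm (f 0)), 0 => //=; rewrite rnorm0 ler01.
Qed.

Lemma opnorm_ge0 f : bounded_op f -> 0 <= opnorm f.
Proof.
move=> bf; apply: (le_trans (rnorm_ge0 (f 0))).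
by apply: opnorm_ub => //; rewrite rnorm0 ler01.
Qed.

Lemma rnorm_opnorm f x : linear f -> bounded_op f ->
  rnorm (f x) <= opnorm f * rnorm x.
Proof.
move=> lf bf; have fZ k u : f (k *: u) = k *: f u.
  have f0 : f 0 = 0.
    by have := lf (-1) 0 0; rewrite scaler0 addr0 scaleN1r addNr.
  by have := lf k u 0; rewrite addr0 f0 addr0.
have [x0|x0] := eqVneq (rnorm x) 0.
  have fx0 : f x = 0 by rewrite (rnorm0_eq0 x0) -(scale0r 0) fZ scale0r.
  by rewrite fx0 x0 rnorm0 mulr0.
have xgt0 : 0 < rnorm x by rewrite lt_def x0 rnorm_ge0.
have nV : rnorm ((rnorm x)^-1%:C : R[i]) = (rnorm x)^-1.
  by rewrite rnorm_real ger0_norm// invr_ge0 rnorm_ge0.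
have : rnorm (f ((rnorm x)^-1%:C *: x)) <= opnorm f.
  by apply: opnorm_ub => //; rewrite rnormZ nV mulVf.
by rewrite fZ rnormZ nV mulrC ler_pdivrMr.
Qed.

End bounded_operators.

Section dual.
Context (R : realType) (V : normedModType R[i]).

Definition is_dual : pred (V -> R[i]^o) :=
  fun f => `[< linear f /\ bounded_op f >].

Record dual := Dual { dual_fun :> V -> R[i]^o ; dualP : is_dual dual_fun }.

HB.instance Definition _ := [isSub for dual_fun].
HB.instance Definition _ := [Choice of dual by <:].

Lemma is_dual_submod : subsemimod_closed is_dual.
Proof.
split; first split.
- apply/asboolP; split; first by move=> k x y; rewrite [RHS]addr0 [RHS]scaler0.
  by exists 0 => x; rewrite mul0r rnorm0.
- move=> f g /asboolP[lf [M fM]] /asboolP[lg [N gN]]; apply/asboolP; split.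
    move=> k x y; rewrite -[LHS]/(f _ + g _) lf lg.
    by rewrite -[in RHS]/(f _ + g _) [in RHS]scalerDr addrACA.
  exists (M + N) => x; rewrite (le_trans (rnormD _ _))// mulrDl.
  exact: lerD.
- move=> k f /asboolP[lf [M fM]]; apply/asboolP; split.
    move=> l x y; rewrite -[LHS]/(k *: f _) lf.
    by rewrite scalerDr !scalerA mulrC -scalerA.
  exists (rnorm k * M) => x.
  by rewrite (rnormZ k) -mulrA ler_wpM2l// rnorm_ge0.
Qed.

HB.instance Definition _ :=
  GRing.SubChoice_isSubLmodule.Build R[i] (V -> R[i]^o) is_dual dual
    is_dual_submod.

Lemma dual_linear (f : dual) : linear f.
Proof. by case: f => f /= /asboolP[]. Qed.

Lemma dual_bounded (f : dual) : bounded_op f.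
Proof. by case: f => f /= /asboolP[]. Qed.

HB.instance Definition _ (f : dual) :=
  GRing.isLinear.Build R[i] V R[i]^o *:%R (dual_fun f) (@dual_linear f).

Let dnorm (f : dual) : R[i] := (opnorm f)%:C.

Let ler_dnormD f g : dnorm (f + g) <= dnorm f + dnorm g.
Proof.
rewrite /dnorm -rmorphD lecR; apply: opnorm_le => x x1.
rewrite (le_trans (rnormD _ _))// lerD// opnorm_ub//; exact: dual_bounded.
Qed.

Let dnormZ k f : dnorm (k *: f) = `|k| * dnorm f.
Proof.
rewrite /dnorm -rnormE -rmorphM/=; congr _%:C.
have le l (g : dual) : opnorm (l *: g : dual) <= rnorm l * opnorm g.
  apply: opnorm_le => x x1; rewrite (rnormZ l) ler_wpM2l ?rnorm_ge0//.
  by apply: opnorm_ub => //; exact: dual_bounded.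
have [->|k0] := eqVneq k 0.
  apply/eqP; rewrite eq_le le rnorm0 mul0r andTb.
  exact: (opnorm_ge0 (@dual_bounded (0 *: f))).
apply/eqP; rewrite eq_le le andTb.
have kgt0 : 0 < rnorm k.
  by rewrite lt_def rnorm_ge0 andbT; apply: contra_neq k0; exact: rnorm0_eq0.
suff kV : rnorm k^-1 = (rnorm k)^-1.
  rewrite -ler_pdivlMl// -kV; have := le k^-1 (k *: f).
  by rewrite scalerA mulVf// scale1r.
apply: (mulIf (lt0r_neq0 kgt0)); rewrite -rnormM mulVf// mulVf ?(lt0r_neq0 kgt0)//.
by rewrite /rnorm normr1.
Qed.

Let dnorm0_eq0 f : dnorm f = 0 -> f = 0.
Proof.
move=> /(@complexI R) f0; apply/val_inj/funext => x /=.
apply/rnorm0_eq0/le_anti; rewrite rnorm_ge0 andbT.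
have := rnorm_opnorm x (dual_linear f) (dual_bounded f).
by rewrite f0 mul0r.
Qed.

HB.instance Definition _ :=
  Lmodule_isNormed.Build R[i] dual ler_dnormD dnormZ dnorm0_eq0.

Lemma dual_normE (f : dual) : rnorm f = opnorm f. Proof. by []. Qed.

End dual.

(* Banach algebras need not be unital, hence this is not an extension of the
   ring structures of MathComp. *)
HB.mixin Record isBanachAlg (K : numFieldType) A & CompleteNormedModule K A := {
  bmul : A -> A -> A ;
  bmulA : associative bmul ;
  bmulDl : left_distributive bmul +%R ;
  bmulDr : right_distributive bmul +%R ;
  bscalerAl : forall (k : K) a b, bmul (k *: a) b = k *: bmul a b ;
  bscalerAr : forall (k : K) a b, bmul a (k *: b) = k *: bmul a b ;
  ler_bnormM : forall a b, `|bmul a b| <= `|a| * `|b| }.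

#[short(type="banachAlgType")]
HB.structure Definition BanachAlg (K : numFieldType) :=
  {A of isBanachAlg K A & CompleteNormedModule K A}.

Notation "a ** b" := (bmul a b) (at level 40, left associativity) : ring_scope.

Section weak_amenability.
Context (R : realType) (A : banachAlgType R[i]).
Implicit Types (a b x : A) (phi : dual A) (D : A -> dual A).

Lemma rnorm_bmul a b : rnorm (a ** b) <= rnorm a * rnorm b.
Proof. by rewrite -lecR rmorphM/= !rnormE ler_bnormM. Qed.

Lemma lact_subproof a phi : is_dual ((fun x => phi (x ** a)) : A -> R[i]^o).
Proof.
apply/asboolP; split.
  by move=> k x y; rewrite bmulDl bscalerAl linearP.
have [M phiM] := dual_bounded phi.
exists (`|M| * rnorm a) => x; apply: (le_trans (phiM _)).
apply: (le_trans (ler_wpM2r (rnorm_ge0 _) (ler_norm M))).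
by rewrite -mulrA ler_wpM2l// mulrC rnorm_bmul.
Qed.

Lemma ract_subproof phi a : is_dual ((fun x => phi (a ** x)) : A -> R[i]^o).
Proof.
apply/asboolP; split.
  by move=> k x y; rewrite bmulDr bscalerAr linearP.
have [M phiM] := dual_bounded phi.
exists (`|M| * rnorm a) => x; apply: (le_trans (phiM _)).
apply: (le_trans (ler_wpM2r (rnorm_ge0 _) (ler_norm M))).
by rewrite -mulrA ler_wpM2l// rnorm_bmul.
Qed.

Definition lact a phi : dual A := Dual (lact_subproof a phi).

Definition ract phi a : dual A := Dual (ract_subproof phi a).

Definition bounded_derivation D :=
  [/\ linear D, bounded_op D &
      forall a b, D (a ** b) = lact a (D b) + ract (D a) b].

Definition ad phi : A -> dual A := fun a => lact a phi - ract phi a.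

Definition weakly_amenable :=
  forall D, bounded_derivation D -> exists phi, D = ad phi.

(* If A is not weakly amenable, no constant is admissible and the infimum of
   the empty set is +oo. *)
Definition WAM : \bar R :=
  ereal_inf [set C%:E | C in [set C : R | 0 <= C /\
    forall D, bounded_derivation D ->
      exists phi, D = ad phi /\ rnorm phi <= C * opnorm D]].

End weak_amenability.
Definition finsupp (R : realType) (I : Type) (x : I -> R[i]^o) : Prop :=
  finite_set [set i | x i != 0].

(* bsl_fun identifies an element of the Banach space with a function on I.
   bsl_contractive says at once that every element is a bounded function and
   that the inclusion into ell_infty(I) is contractive; boundedness of x in
   bsl_solid follows from that of y. *)
Record bsl (R : realType) (I : Type) := BSL {
  bsl_space :> completeNormedModType R[i] ;
  bsl_fun : {linear bsl_space -> (I -> R[i]^o)} ;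
  bsl_fun_inj : injective bsl_fun ;
  bsl_finsupp : forall x : I -> R[i]^o, finsupp x -> range bsl_fun x ;
  bsl_dense : dense [set e : bsl_space | finsupp (bsl_fun e)] ;
  bsl_solid : forall (y : bsl_space) (x : I -> R[i]^o),
    (forall i, `|x i| <= `|bsl_fun y i|) ->
    exists2 e : bsl_space, bsl_fun e = x & `|e| <= `|y| ;
  bsl_contractive : forall (e : bsl_space) i, `|bsl_fun e i| <= `|e| }.

Section bsl_theory.
Context (R : realType) (I : Type) (E : bsl R I).
Implicit Types x y : I -> R[i]^o.

Lemma bsl_funD (e f : E) i :
  bsl_fun E (e + f) i = bsl_fun E e i + bsl_fun E f i.
Proof. by rewrite linearD. Qed.

Lemma bsl_funB (e f : E) i :
  bsl_fun E (e - f) i = bsl_fun E e i - bsl_fun E f i.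
Proof. by rewrite linearB. Qed.

Lemma bsl_funZ k (e : E) i : bsl_fun E (k *: e) i = k * bsl_fun E e i.
Proof. by rewrite linearZ. Qed.

(* the element of E with underlying function x, for x in E *)
Definition bsl_of x : E := xget 0 [set e : E | bsl_fun E e = x].

Lemma bsl_ofK x : range (bsl_fun E) x -> bsl_fun E (bsl_of x) = x.
Proof.
by move=> [e _ ex]; rewrite /bsl_of; case: xgetP => [f _ //|/(_ e)]; case.
Qed.

Lemma bsl_funK : cancel (bsl_fun E) bsl_of.
Proof. by move=> e; apply: (@bsl_fun_inj _ _ E); rewrite bsl_ofK//; exists e. Qed.

Lemma ler_bsl_norm (e f : E) :
  (forall i, `|bsl_fun E e i| <= `|bsl_fun E f i|) -> `|e| <= `|f|.
Proof. by move=> /bsl_solid[g /(@bsl_fun_inj _ _ E) ->]. Qed.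

Lemma bsl_solid_range x (f : E) :
  (forall i, `|x i| <= `|bsl_fun E f i|) -> range (bsl_fun E) x.
Proof. by move=> /bsl_solid[e <- _]; exists e. Qed.

End bsl_theory.

Definition bsl_C (R : realType) (I : Type) (E : bsl R I) : \bar R :=
  ereal_sup [set (rnorm (bsl_of E \1_F))%:E | F in @finite_set I].

Section families.
Context (K : numFieldType) (I : Type) (A : I -> lmodType K).

Definition families := forall i, A i.

HB.instance Definition _ := Choice.on families.

Let zero : families := fun i => 0.
Let add (a b : families) : families := fun i => a i + b i.
Let opp (a : families) : families := fun i => - a i.
Let scale k (a : families) : families := fun i => k *: a i.

Let addA : associative add.
Proof. by move=> a b c; apply: functional_extensionality_dep => i; exact: addrA. Qed.
Let addC : commutative add.
Proof. by move=> a b; apply: functional_extensionality_dep => i; exact: addrC. Qed.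
Let add0 : left_id zero add.
Proof. by move=> a; apply: functional_extensionality_dep => i; exact: add0r. Qed.
Let addN : left_inverse zero opp add.
Proof. by move=> a; apply: functional_extensionality_dep => i; exact: addNr. Qed.

HB.instance Definition _ := GRing.isZmodule.Build families addA addC add0 addN.

Let scaleA j k a : scale j (scale k a) = scale (j * k) a.
Proof. by apply: functional_extensionality_dep => i; exact: scalerA. Qed.
Let scale1 : left_id 1 scale.
Proof. by move=> a; apply: functional_extensionality_dep => i; exact: scale1r. Qed.
Let scaleDr : right_distributive scale +%R.
Proof. by move=> k a b; apply: functional_extensionality_dep => i; exact: scalerDr. Qed.
Let scaleDl a : {morph scale^~ a : j k / j + k}.
Proof. by move=> j k; apply: functional_extensionality_dep => i; exact: scalerDl. Qed.

HB.instance Definition _ :=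
  GRing.Zmodule_isLmodule.Build K families scaleA scale1 scaleDr scaleDl.

End families.

Lemma lipschitz1_cauchy (K : numFieldType) (V W : normedModType K) (g : V -> W)
    (F : set_system V) : ProperFilter F ->
  (forall x y, `|g x - g y| <= `|x - y|) -> cauchy F -> cauchy (g @ F).
Proof.
move=> FF gl Fc; apply/cauchyP => e e0.
have /cauchyP/(_ e e0)[x Fx] := Fc.
exists (g x); rewrite -[_ _]/(F (g @^-1` ball (g x) e)).
apply: filterS Fx => y; rewrite -!ball_normE /=.
by move=> xy; exact: le_lt_trans (gl _ _) xy.
Qed.

Section E_sum.
Context (R : realType) (I : Type) (E : bsl R I) (A : I -> banachAlgType R[i]).
Local Notation famA := (families A).

Definition norms (a : famA) : I -> R[i]^o := fun i => `|a i|.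

Definition is_Esum : pred famA := fun a => `[< range (bsl_fun E) (norms a) >].

Record Esum := MkEsum { Esum_fun :> forall i, A i ; EsumP : is_Esum Esum_fun }.

HB.instance Definition _ := [isSub of Esum for (Esum_fun : Esum -> famA)].
HB.instance Definition _ := [Choice of Esum by <:].

Lemma is_Esum_submod : subsemimod_closed is_Esum.
Proof.
split; first split.
- apply/asboolP; exists 0 => //; rewrite linear0; apply/funext => i /=.
  by rewrite /norms normr0.
- move=> a b /asboolP[e _ ea] /asboolP[f _ fb]; apply/asboolP.
  apply: (@bsl_solid_range _ _ _ _ (e + f)) => i.
  rewrite bsl_funD ea fb /norms normr_id.
  by rewrite [leRHS]ger0_norm ?addr_ge0// ler_normD.
- move=> k a /asboolP[e _ ea]; apply/asboolP.
  apply: (@bsl_solid_range _ _ _ _ (k *: e)) => i.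
  by rewrite bsl_funZ ea /norms normr_id normrM normr_id normrZ.
Qed.

HB.instance Definition _ :=
  GRing.SubChoice_isSubLmodule.Build R[i] famA is_Esum Esum is_Esum_submod.

Implicit Types a b c : Esum.

Lemma Esum_addE a b i : (a + b : Esum) i = a i + b i. Proof. by []. Qed.
Lemma Esum_oppE a i : (- a : Esum) i = - a i. Proof. by []. Qed.
Lemma Esum_scaleE k a i : (k *: a : Esum) i = k *: a i. Proof. by []. Qed.
Lemma Esum_zeroE i : (0 : Esum) i = 0. Proof. by []. Qed.
Lemma Esum_eqP a b : (forall i, a i = b i) -> a = b.
Proof. by move=> ab; apply/val_inj/functional_extensionality_dep => i /=. Qed.

(* the sequence of norms of a, as an element of E *)
Definition Esum_norms a : E := bsl_of E (norms a).

Lemma Esum_normsE a i : bsl_fun E (Esum_norms a) i = `|a i|.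
Proof. by rewrite bsl_ofK//; apply/asboolP/EsumP. Qed.

Let norm a : R[i] := `|Esum_norms a|.

Let normD a b : norm (a + b) <= norm a + norm b.
Proof.
apply: le_trans (ler_normD _ _); apply: ler_bsl_norm => i.
rewrite bsl_funD !Esum_normsE normr_id ger0_norm ?addr_ge0//.
exact: ler_normD.
Qed.

Let normZ k a : norm (k *: a) = `|k| * norm a.
Proof.
rewrite /norm -normrZ.
apply/eqP; rewrite eq_le; apply/andP; split; apply: ler_bsl_norm => i;
  by rewrite bsl_funZ !Esum_normsE normrM !normr_id normrZ.
Qed.

Let norm_eq0 a : norm a = 0 -> a = 0.
Proof.
move=> /normr0_eq0 a0; apply: Esum_eqP => i; apply/normr0_eq0.
by rewrite -Esum_normsE a0 linear0.
Qed.

HB.instance Definition _ :=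
  Lmodule_isNormed.Build R[i] Esum normD normZ norm_eq0.

Lemma Esum_normE a : `|a| = `|Esum_norms a|. Proof. by []. Qed.

Lemma Esum_norms_lip a b : `|Esum_norms a - Esum_norms b| <= `|a - b|.
Proof.
apply: ler_bsl_norm => i; rewrite bsl_funB !Esum_normsE normr_id.
exact: ler_dist_dist.
Qed.

Lemma Esum_coord_norm a i : `|a i| <= `|a|.
Proof. by rewrite Esum_normE -[leLHS]normr_id -Esum_normsE bsl_contractive. Qed.

Let Esum_complete (F : set_system Esum) : ProperFilter F -> cauchy F -> cvg F.
Proof.
move=> FF Fc.
pose pr i (a : Esum) : A i := a i.
have prc i : cvg (pr i @ F).
  apply/cauchy_cvgP/lipschitz1_cauchy => // a b; exact: Esum_coord_norm (a - b) i.
pose l : famA := fun i => lim (pr i @ F).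
have Nc (g : Esum -> E) : (forall a b, `|g a - g b| <= `|a - b|) -> cvg (g @ F).
  by move=> gl; apply/cauchy_cvgP/lipschitz1_cauchy.
have evl (e f : E) i : `|bsl_fun E e i - bsl_fun E f i| <= `|e - f|.
  by rewrite -bsl_funB bsl_contractive.
have coordl (g : Esum -> E) (b : famA) i :
    cvg (g @ F) -> (forall a, bsl_fun E (g a) i = `|b i - a i|) ->
    bsl_fun E (lim (g @ F)) i = `|b i - l i|.
  move=> gF gb; apply/eqP; rewrite -subr_eq0 -normr_eq0.
  apply/negPn/negP => d0.
  set d := `|_ - _| in d0; have dgt0 : 0 < d by rewrite lt_def d0 normr_ge0.
  have d2 : 0 < d / 2 by rewrite divr_gt0.
  have /cvgrPdist_lt/(_ _ d2) H1 := gF.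
  have /cvgrPdist_lt/(_ _ d2) H2 := prc i.
  have [a [Ha1 Ha2]] := filter_ex (filterI H1 H2).
  have : d < d.
    rewrite {2}(splitr d); apply: le_lt_trans (ltrD Ha1 Ha2).
    rewrite /d -(subrKA (bsl_fun E (g a) i)); apply: le_trans (ler_normD _ _) _.
    apply: lerD; first exact: evl.
    rewrite gb; apply: le_trans (ler_dist_dist _ _) _.
    by rewrite opprB addrC subrKA.
  by rewrite ltxx.
have lE : is_Esum l.
  apply/asboolP; exists (lim (Esum_norms @ F)) => //.
  apply/funext => i; rewrite (coordl _ 0) ?sub0r ?normrN//.
    by apply: Nc; exact: Esum_norms_lip.
  by move=> a; rewrite Esum_normsE sub0r normrN.
pose L := MkEsum lE.
apply/cvg_ex; exists L; apply/cvgrPdist_lt => e e0.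
have e3 : 0 < e / 3 by rewrite divr_gt0.
have /cauchyP/(_ _ e3)[b Fb] := Fc.
pose g a := Esum_norms (b - a).
have gl a c : `|g a - g c| <= `|a - c|.
  apply: le_trans (Esum_norms_lip _ _) _.
  by rewrite opprB addrC subrKA distrC.
have gF := Nc _ gl.
have limg : lim (g @ F) = Esum_norms (b - L).
  apply: (@bsl_fun_inj _ _ E); apply/funext => i.
  by rewrite Esum_normsE (coordl _ (b : famA)) // => a; rewrite Esum_normsE.
have bL : `|b - L| < e / 3 + e / 3.
  have /cvgrPdist_lt/(_ _ e3) H1 := gF.
  have [a [/= Ha1 Ha2]] := filter_ex (filterI H1 Fb).
  rewrite Esum_normE -limg -(subrK (g a) (lim _)).
  by apply: le_lt_trans (ler_normD _ _) _; exact: ltrD.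
apply: filterS Fb => a; rewrite -ball_normE /= => ba.
rewrite -(subrKA b); apply: le_lt_trans (ler_normD _ _) _.
have -> : e = (e / 3 + e / 3) + e / 3.
  by rewrite -!mulrDl -mulr2n -mulrSr -[e *+ 3]mulr_natr mulfK.
by apply: ltrD => //; rewrite distrC.
Qed.

HB.instance Definition _ := Uniform_isComplete.Build Esum Esum_complete.

Lemma is_Esum_mul a b : is_Esum ((fun i => a i ** b i) : famA).
Proof.
apply/asboolP; apply: (@bsl_solid_range _ _ _ _ (`|a| *: Esum_norms b)) => i.
rewrite bsl_funZ Esum_normsE /norms normr_id normrM !normr_id.
apply: le_trans (ler_bnormM _ _) _; rewrite ler_wpM2r//.
exact: Esum_coord_norm.
Qed.

Let mul a b : Esum := MkEsum (is_Esum_mul a b).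

Let mulA : associative mul.
Proof. by move=> a b c; apply: Esum_eqP => i; exact: bmulA. Qed.
Let mulDl : left_distributive mul +%R.
Proof. by move=> a b c; apply: Esum_eqP => i; exact: bmulDl. Qed.
Let mulDr : right_distributive mul +%R.
Proof. by move=> a b c; apply: Esum_eqP => i; exact: bmulDr. Qed.
Let scaleAl k a b : mul (k *: a) b = k *: mul a b.
Proof. by apply: Esum_eqP => i; exact: bscalerAl. Qed.
Let scaleAr k a b : mul a (k *: b) = k *: mul a b.
Proof. by apply: Esum_eqP => i; exact: bscalerAr. Qed.
Let normM a b : `|mul a b| <= `|a| * `|b|.
Proof.
rewrite 2!Esum_normE [X in _ <= _ * X]Esum_normE -Esum_normE.
rewrite -[X in X * _]normr_id -normrZ; apply: ler_bsl_norm => i.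
rewrite bsl_funZ !Esum_normsE normr_id normrM !normr_id.
apply: le_trans (ler_bnormM _ _) _; rewrite ler_wpM2r//.
exact: Esum_coord_norm.
Qed.

HB.instance Definition _ :=
  isBanachAlg.Build R[i] Esum mulA mulDl mulDr scaleAl scaleAr normM.

Lemma Esum_mulE a b i : (a ** b) i = a i ** b i. Proof. by []. Qed.

End E_sum.

(* Only the values on [0, +oo[ matter; there phi is nonnegative, being
   nondecreasing with phi 0 = 0. *)
Record orlicz (R : realType) := Orlicz {
  orlicz_fun :> R -> R ;
  orlicz_convex :
    convex_function (`[0, +oo[%classic : set R^o) (orlicz_fun : R^o -> R^o) ;
  orlicz_continuous : {within `[0, +oo[, continuous orlicz_fun} ;
  orlicz_ndecr : {in `[0, +oo[ &, {homo orlicz_fun : s t / s <= t}} ;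
  orlicz0 : orlicz_fun 0 = 0 ;
  orlicz_cvgy : orlicz_fun t @[t --> +oo] --> +oo }.

Definition orlicz_a (R : realType) (phi : orlicz R) : R :=
  sup [set t | 0 <= t /\ phi t = 0].

(* The infimum of the empty set is +oo, so the Orlicz space is
   [set x | lux phi x < +oo]. *)
Definition lux (R : realType) (I : choiceType) (phi : orlicz R)
    (x : I -> R[i]^o) : \bar R :=
  ereal_inf [set l%:E | l in [set l : R | 0 < l /\
    (\esum_(i in [set: I]) (phi (rnorm (x i) / l))%:E <= 1)%E]].

Section orlicz_theory.
Context (R : realType) (I : choiceType) (phi : orlicz R).
Implicit Types (x y z : I -> R[i]^o) (l m : R) (s : seq I).

Lemma orlicz_le r t : 0 <= r -> r <= t -> phi r <= phi t.
Proof.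
move=> r0 rt; apply: orlicz_ndecr => //; rewrite in_itv/= andbT//.
exact: le_trans rt.
Qed.

Lemma orlicz_ge0 t : 0 <= t -> 0 <= phi t.
Proof. by move=> t0; rewrite -(orlicz0 phi) orlicz_le. Qed.

Lemma orlicz_conv (p q r t : R) : 0 <= r -> 0 <= t -> 0 <= p -> 0 <= q ->
  p + q = 1 -> phi (p * r + q * t) <= p * phi r + q * phi t.
Proof.
move=> r0 t0 p0 q0 pq.
have p1 : p <= 1 by rewrite -pq lerDl.
have qE : q = 1 - p by rewrite -pq addrC addKr.
have := @orlicz_convex R phi (Itv01 p0 p1) r t.
rewrite !inE/= !in_itv/= !andbT => /(_ r0 t0).
by rewrite qE.
Qed.

Let admissible x l := 0 < l /\
  forall s, uniq s -> \sum_(i <- s) phi (rnorm (x i) / l) <= 1.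

Let admissibleP x l : 0 < l ->
  ((\esum_(i in [set: I]) (phi (rnorm (x i) / l))%:E <= 1)%E <->
   forall s, uniq s -> \sum_(i <- s) phi (rnorm (x i) / l) <= 1).
Proof.
move=> l0; split=> [h s us|h].
  rewrite -lee_fin -sumEFin; apply: le_trans h.
  apply: ereal_sup_ubound; exists [set` s]; last by rewrite -fsbig_seq.
  by split; [exact: finite_seq|exact: subsetT].
apply: ge_ereal_sup => _ [F [finF _] <-].
by rewrite fsbig_finite// sumEFin lee_fin h.
Qed.

Let adm_lux x l : admissible x l -> (lux phi x <= l%:E)%E.
Proof.
by move=> [l0 h]; apply: ereal_inf_lbound; exists l => //; split => //; apply/admissibleP.
Qed.

Let adm_le x l m : l <= m -> admissible x l -> admissible x m.
Proof.
move=> lm [l0 h]; have m0 := lt_le_trans l0 lm.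
split=> // s /h; apply: le_trans; apply: ler_sum => i _.
rewrite orlicz_le ?divr_ge0 ?rnorm_ge0 ?(ltW m0)//.
by rewrite ler_wpM2l ?rnorm_ge0// lef_pV2.
Qed.

Let lux_adm x l : (lux phi x < l%:E)%E -> admissible x l.
Proof.
move=> /ereal_inf_lt[_ [m [m0 /(admissibleP _ m0) h] <-]].
by rewrite lte_fin => /ltW ml; apply: (adm_le ml); split.
Qed.

Lemma lux_ge0 x : (0 <= lux phi x)%E.
Proof. by apply: le_ereal_inf_tmp => _ [l [l0 _] <-]; rewrite lee_fin ltW. Qed.

Let lux_leP x r : 0 <= r ->
  (forall e, 0 < e -> admissible x (r + e)) <-> (lux phi x <= r%:E)%E.
Proof.
move=> r0; split=> [h|xr e e0].
  by apply/lee_addgt0Pr => e e0; rewrite -EFinD; apply/adm_lux/h.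
by apply: lux_adm; apply: le_lt_trans xr _; rewrite lte_fin ltrDl.
Qed.

Let le_lux_ge0 x r : (lux phi x <= r%:E)%E -> 0 <= r.
Proof. by move=> /(le_trans (lux_ge0 x)); rewrite lee_fin. Qed.

Lemma luxD x y r t : (lux phi x <= r%:E -> lux phi y <= t%:E ->
  lux phi (x + y)%R <= (r + t)%:E)%E.
Proof.
move=> xr yt; have r0 := le_lux_ge0 xr; have t0 := le_lux_ge0 yt.
apply/lux_leP; first exact: addr_ge0.
move=> e e0; have e2 : 0 < e / 2 by rewrite divr_gt0.
have [l0 hl] := (lux_leP x r0).2 xr _ e2.
have [m0 hm] := (lux_leP y t0).2 yt _ e2.
have -> : r + t + e = (r + e / 2) + (t + e / 2) by rewrite addrACA -splitr.
set l := r + e / 2 in l0 hl *; set m := t + e / 2 in m0 hm *.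
have lm0 : 0 < l + m by exact: addr_gt0.
split=> // s us.
pose p := l / (l + m); pose q := m / (l + m).
have p0 : 0 <= p by rewrite divr_ge0// ltW.
have q0 : 0 <= q by rewrite divr_ge0// ltW.
have pq : p + q = 1 by rewrite -mulrDl divff ?gt_eqF.
apply: (@le_trans _ _ (\sum_(i <- s) (p * phi (rnorm (x i) / l) +
                                      q * phi (rnorm (y i) / m)))).
  apply: ler_sum => i _.
  have xl : 0 <= rnorm (x i) / l by rewrite divr_ge0 ?rnorm_ge0// ltW.
  have ym : 0 <= rnorm (y i) / m by rewrite divr_ge0 ?rnorm_ge0// ltW.
  apply: le_trans (orlicz_conv xl ym p0 q0 pq); apply: orlicz_le.
    by rewrite divr_ge0 ?rnorm_ge0// ltW.
  have -> : p * (rnorm (x i) / l) + q * (rnorm (y i) / m) =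
      (rnorm (x i) + rnorm (y i)) / (l + m).
    rewrite [p * _]mulrC [q * _]mulrC /p /q !mulrA.
    by rewrite !divfK ?gt_eqF// mulrDl.
  by rewrite ler_wpM2r ?invr_ge0 ?(ltW lm0)// rnormD.
rewrite big_split/= -!mulr_sumr -pq lerD// ler_piMr//; [exact: hl|exact: hm].
Qed.

Lemma le_lux x y : (forall i, rnorm (x i) <= rnorm (y i)) ->
  (lux phi x <= lux phi y)%E.
Proof.
move=> xy; apply: le_ereal_inf_tmp => _ [l [l0 /(admissibleP _ l0) h] <-].
apply: adm_lux; split=> // s us; apply: le_trans (h _ us).
apply: ler_sum => i _; apply: orlicz_le.
  by rewrite divr_ge0 ?rnorm_ge0// ltW.
by rewrite ler_wpM2r// invr_ge0 ltW.
Qed.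

Lemma lux0 : (lux phi (0%R : I -> R[i]^o) <= 0)%E.
Proof.
apply/lux_leP => // e; rewrite add0r => e0; split=> // s us.
by rewrite big1// => i _; rewrite rnorm0 mul0r orlicz0.
Qed.

Lemma luxZ k x r : (lux phi x <= r%:E)%E ->
  (lux phi (k *: x)%R <= (rnorm k * r)%:E)%E.
Proof.
move=> xr; have r0 := le_lux_ge0 xr.
have [->|k0] := eqVneq k 0; first by rewrite scale0r rnorm0 mul0r lux0.
have kgt0 : 0 < rnorm k.
  by rewrite lt_def rnorm_ge0 andbT; apply: contra_neq k0; exact: rnorm0_eq0.
apply/lux_leP; first by rewrite mulr_ge0// rnorm_ge0.
move=> e e0; have [l0 h] := (lux_leP x r0).2 xr _ (divr_gt0 e0 kgt0).
have -> : rnorm k * r + e = rnorm k * (r + e / rnorm k).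
  by rewrite mulrDr mulrCA divff ?mulr1// gt_eqF.
split=> [|s us]; first exact: mulr_gt0.
apply: le_trans (h _ us); apply: ler_sum => i _.
rewrite (rnormZ k (x i)) invfM mulrACA divff ?mul1r// gt_eqF//.
Qed.

Lemma luxN x : lux phi (- x) = lux phi x.
Proof.
by apply/eqP; rewrite eq_le; apply/andP; split; apply: le_lux => i;
  rewrite (rnormN (x i)).
Qed.

Lemma lux_coord : exists2 T : R, 0 < T & forall x r, (lux phi x <= r%:E)%E ->
  forall i, rnorm (x i) <= T * r.
Proof.
have /cvgryPgt/(_ 1) [T [_ hT]] := @orlicz_cvgy R phi.
have T0 : 0 < `|T| + 1 by rewrite ltr_wpDl.
exists (`|T| + 1) => // x r xr i; have r0 := le_lux_ge0 xr.
apply/ler_addgt0Pr => e e0.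
have [l0 h] := (lux_leP x r0).2 xr _ (divr_gt0 e0 T0).
have -> : (`|T| + 1) * r + e = (`|T| + 1) * (r + e / (`|T| + 1)).
  by rewrite mulrDr mulrCA divff ?mulr1// gt_eqF.
rewrite -ler_pdivrMr// leNgt; apply/negP => Tx.
have /hT : T < rnorm (x i) / (r + e / (`|T| + 1)).
  by apply: le_lt_trans Tx; rewrite (le_trans (ler_norm T))// lerDl.
by rewrite ltNge; have := h [:: i] isT; rewrite big_seq1 => ->.
Qed.

Lemma lux_finsupp x : finsupp x -> (lux phi x < +oo)%E.
Proof.
move=> /finite_seqP[s0 xs0]; pose S := undup s0.
have Sx i : i \notin S -> x i = 0.
  rewrite mem_undup => iS; apply/eqP/negPn/negP => xi; move/negP: iS; apply.
  by have : [set i | x i != 0] i by []; rewrite xs0.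
pose M := \sum_(i <- S) phi (rnorm (x i)).
have M0 : 0 <= M by apply: sumr_ge0 => i _; rewrite orlicz_ge0// rnorm_ge0.
have M1 : 0 < M + 1 by rewrite ltr_wpDl.
apply: (@le_lt_trans _ _ (M + 1)%:E); last exact: ltry.
apply: adm_lux; split=> // s us.
pose p := (M + 1)^-1.
have p0 : 0 <= p by rewrite invr_ge0 ltW.
have p1 : p <= 1 by rewrite invf_le1// lerDr.
have phip i : phi (rnorm (x i) / (M + 1)) <= p * phi (rnorm (x i)).
  have := @orlicz_conv p (1 - p) (rnorm (x i)) 0 (rnorm_ge0 _) (lexx 0) p0.
  rewrite subr_ge0 p1 mulr0 orlicz0 mulr0 !addr0 mulrC => /(_ isT).
  by apply; rewrite addrC subrK.
apply: (@le_trans _ _ (\sum_(i <- s) p * phi (rnorm (x i)))).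
  exact: ler_sum.
rewrite -mulr_sumr mulrC ler_pdivrMr// mul1r.
apply: (@le_trans _ _ M); last by rewrite lerDl.
rewrite (bigID (mem S))/= [X in _ + X]big1 ?addr0; last first.
  by move=> i /Sx ->; rewrite rnorm0 orlicz0.
rewrite -big_filter /M [leRHS](bigID (mem s))/=.
rewrite -[X in _ <= X + _]big_filter.
rewrite (perm_big [seq i <- S | i \in s]); last first.
  apply: uniq_perm; rewrite ?filter_uniq ?undup_uniq//.
  by move=> i; rewrite !mem_filter andbC.
by rewrite lerDl sumr_ge0// => i _; rewrite orlicz_ge0// rnorm_ge0.
Qed.

Lemma lux_fin_le x r : 0 <= r ->
  (forall s, uniq s ->
    (lux phi (fun i => if i \in s then x i else 0)%R <= r%:E)%E) ->
  (lux phi x <= r%:E)%E.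
Proof.
move=> r0 h; apply/lux_leP => // e e0; split; first exact: ltr_wpDl.
move=> s us; have [_ /(_ _ us)] := (lux_leP _ r0).2 (h _ us) _ e0.
by rewrite !big_seq; under eq_bigr => i -> do [].
Qed.

End orlicz_theory.

Lemma rnormi (R : realType) : rnorm ('i : R[i]) = 1.
Proof.
apply: (@complexI R).
by rewrite rnormE normc_def/= expr0n/= expr1n add0r sqrtr1.
Qed.

Lemma complex_complete (R : realType) (F : set_system R[i]^o) :
  ProperFilter F -> cauchy F -> cvg F.
Proof.
move=> FF Fc.
have rnorm_part (p : R[i]^o -> R) : (forall z w, p (z - w) = p z - p w) ->
    (forall z, `|p z| <= rnorm z) -> cvg (p @ F).
  move=> pB pn; apply/cauchy_cvgP/cauchyP => e e0.
  have /cauchyP/(_ e%:C) := Fc; rewrite ltcR => /(_ e0)[z Fz].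
  exists (p z); rewrite -[_ _]/(F (p @^-1` ball (p z) e)).
  apply: filterS Fz => w; rewrite -!ball_normE/= -rnormE ltcR => zw.
  by rewrite -pB; exact: le_lt_trans (pn _) zw.
have ReF : cvg ((@complex.Re R : R[i]^o -> R) @ F).
  apply: rnorm_part => [[a b] [c d]//|z].
  by rewrite -lecR rnormE normc_ge_Re.
have ImF : cvg ((@complex.Im R : R[i]^o -> R) @ F).
  apply: rnorm_part => [[a b] [c d]//|z].
  rewrite -lecR -[rnorm z]mul1r -(rnormi R) -rnormM rnormE.
  rewrite -[leLHS]/(`|complex.Im z|%:C) -normrN.
  have -> : - complex.Im z = complex.Re ('i * z : R[i]).
    by case: z => u v /=; rewrite mul0r mul1r add0r.
  exact: normc_ge_Re.
set a := lim _ in ReF; set b := lim _ in ImF.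
apply/cvg_ex; exists (a +i* b : R[i]^o); apply/cvgrPdist_lt => e e0.
have eE : e = (complex.Re e)%:C by rewrite RRe_real// gtr0_real.
have r0 : 0 < complex.Re e by rewrite -ltcR -eE.
have r2 : 0 < complex.Re e / 2 by rewrite divr_gt0.
have /cvgrPdist_lt/(_ _ r2) H1 := ReF.
have /cvgrPdist_lt/(_ _ r2) H2 := ImF.
apply: filterS2 H1 H2 => -[c d] /= ac bd.
rewrite eE -rnormE ltcR.
have -> : (a +i* b : R[i]) - (c +i* d) = (a - c)%:C + 'i * (b - d)%:C.
  by simpc.
rewrite (le_lt_trans (rnormD _ _))// rnormM !rnorm_real.
by rewrite rnormi mul1r [ltRHS]splitr ltrD.
Qed.

(* closure of the finitely supported functions in the Orlicz space *)
Definition is_heart (R : realType) (I : choiceType) (phi : orlicz R) :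
    pred (I -> R[i]^o) := fun x =>
  `[< (lux phi x < +oo)%E /\
      forall e : R, 0 < e ->
        exists y, finsupp y /\ (lux phi (x - y)%R < e%:E)%E >].

(* The scaling factor c of the norm is a parameter of the type, so that
   each scaling gets its own normed space. *)
Record heart (R : realType) (I : choiceType) (phi : orlicz R) (c : {posnum R}) :=
  Heart { heart_fun :> I -> R[i]^o ; heartP : is_heart phi heart_fun }.

Section orlicz_heart.
Context (R : realType) (I : choiceType) (phi : orlicz R) (c : {posnum R}).
Implicit Types (x y : I -> R[i]^o).

Local Notation is_heart := (@is_heart R I phi).
Local Notation heart := (@heart R I phi c).
Local Notation Heart := (@Heart R I phi c _).
Local Notation heart_fun := (@heart_fun R I phi c).

HB.instance Definition _ := [isSub for heart_fun].
HB.instance Definition _ := [Choice of heart by <:].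

Let finsuppD x y : finsupp x -> finsupp y -> finsupp (x + y).
Proof.
move=> fx fy; apply: (@sub_finite_set _ _ ([set i | x i != 0] `|` [set i | y i != 0])).
  move=> i /= xy; have [x0|xN0] := eqVneq (x i) 0; last by left.
  by right; move: xy; rewrite -[(x + y) i]/(x i + y i) x0 add0r.
by rewrite finite_setU.
Qed.

Let finsupp_sub x y : (forall i, x i = 0 -> y i = 0) -> finsupp x -> finsupp y.
Proof.
move=> xy; apply: sub_finite_set => i /=; apply: contra_neq; exact: xy.
Qed.

Let finsupp_heart x : finsupp x -> is_heart x.
Proof.
move=> fx; apply/asboolP; split; first exact: lux_finsupp.
move=> e e0; exists x; split => //; rewrite subrr.
by apply: le_lt_trans (lux0 _ _) _; rewrite lte_fin.
Qed.

Let fin_luxE x : (lux phi x < +oo)%E -> lux phi x = (fine (lux phi x))%:E.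
Proof. by move=> xoo; rewrite fineK// ge0_fin_numE// lux_ge0. Qed.

Lemma is_heart_submod : subsemimod_closed is_heart.
Proof.
split; first split.
- by apply: finsupp_heart; apply: (@sub_finite_set _ _ set0) => // i /=; rewrite eqxx.
- move=> x y /asboolP[xoo hx] /asboolP[yoo hy]; apply/asboolP; split.
    apply: (@le_lt_trans _ _ (fine (lux phi x) + fine (lux phi y))%:E); last exact: ltry.
    by apply: luxD; rewrite -fin_luxE.
  move=> e e0; have e2 : 0 < e / 2 by rewrite divr_gt0.
  have [x' [fx' xx']] := hx _ e2; have [y' [fy' yy']] := hy _ e2.
  exists (x' + y'); split; first exact: finsuppD.
  rewrite opprD addrACA.
  have xx'oo := lt_trans xx' (ltry _); have yy'oo := lt_trans yy' (ltry _).
  rewrite (fin_luxE xx'oo) lte_fin in xx'; rewrite (fin_luxE yy'oo) lte_fin in yy'.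
  apply: (@le_lt_trans _ _ (fine (lux phi (x - x')) + fine (lux phi (y - y')))%:E).
    by apply: luxD; rewrite -fin_luxE.
  by rewrite lte_fin [ltRHS]splitr ltrD.
- move=> k x /asboolP[xoo hx]; apply/asboolP; split.
    apply: (@le_lt_trans _ _ (rnorm k * fine (lux phi x))%:E); last exact: ltry.
    by apply: luxZ; rewrite -fin_luxE.
  move=> e e0; have k1 : 0 < rnorm k + 1 by rewrite ltr_wpDl ?rnorm_ge0.
  have [x' [fx' xx']] := hx _ (divr_gt0 e0 k1).
  exists (k *: x'); split.
    apply: finsupp_sub fx' => i xi0.
    by rewrite -[LHS]/(k *: x' i) xi0 scaler0.
  rewrite -scalerBr.
  apply: (@le_lt_trans _ _ (rnorm k * (e / (rnorm k + 1)))%:E).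
    exact/luxZ/ltW.
  by rewrite lte_fin mulrA ltr_pdivrMr// mulrC ltr_pM2l// ltrDl.
Qed.

HB.instance Definition _ :=
  GRing.SubChoice_isSubLmodule.Build R[i] (I -> R[i]^o) is_heart heart
    is_heart_submod.

Implicit Types f g : heart.

Let hlux f : R := fine (lux phi f).

Let hluxE f : lux phi f = (hlux f)%:E.
Proof. by apply: fin_luxE; case: f => f /= /asboolP[]. Qed.

Let hlux_ge0 f : 0 <= hlux f.
Proof. by rewrite -lee_fin -hluxE lux_ge0. Qed.

Let hlux_leZ k f : hlux (k *: f) <= rnorm k * hlux f.
Proof. by rewrite -lee_fin -hluxE; apply: luxZ; rewrite hluxE. Qed.

Let norm f : R[i] := (c%:num * hlux f)%:C.

Let normD f g : norm (f + g) <= norm f + norm g.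
Proof.
rewrite -rmorphD lecR -mulrDr ler_wpM2l// -lee_fin -hluxE.
by apply: luxD; rewrite hluxE.
Qed.

Let normZ k f : norm (k *: f) = `|k| * norm f.
Proof.
rewrite -rnormE -rmorphM/= mulrCA; congr (_ * _)%:C.
apply/eqP; rewrite eq_le hlux_leZ andTb.
have [->|k0] := eqVneq k 0; first by rewrite rnorm0 mul0r.
have kgt0 : 0 < rnorm k.
  by rewrite lt_def rnorm_ge0 andbT; apply: contra_neq k0; exact: rnorm0_eq0.
rewrite -ler_pdivlMl//.
have kV : rnorm k^-1 = (rnorm k)^-1.
  apply: (mulIf (lt0r_neq0 kgt0)); rewrite -rnormM mulVf// mulVf ?(lt0r_neq0 kgt0)//.
  by rewrite /rnorm normr1.
by rewrite -kV; have := hlux_leZ k^-1 (k *: f); rewrite scalerA mulVf// scale1r.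
Qed.

Let hlux_coord : exists2 T : R, 0 < T & forall f i, rnorm (f i) <= T * hlux f.
Proof.
by have [T T0 h] := lux_coord I phi; exists T => // f i; apply: h; rewrite hluxE.
Qed.

Let norm_eq0 f : norm f = 0 -> f = 0.
Proof.
move=> /(@complexI R)/eqP; rewrite mulf_eq0 gt_eqF//= => /eqP f0.
apply/val_inj/funext => i /=; apply/rnorm0_eq0/le_anti; rewrite rnorm_ge0 andbT.
by have [T _ /(_ f i)] := hlux_coord; rewrite f0 mulr0.
Qed.

HB.instance Definition _ := Lmodule_isNormed.Build R[i] heart normD normZ norm_eq0.

Lemma heart_normE f : `|f| = (c%:num * fine (lux phi f))%:C.
Proof. by []. Qed.

Let ltr_heart f (e : R) : (`|f| < e%:C) = (hlux f < e / c%:num).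
Proof. by rewrite heart_normE ltcR ltr_pdivlMr// mulrC. Qed.


Let heart_complete (F : set_system heart) : ProperFilter F -> cauchy F -> cvg F.
Proof.
move=> FF Fc.
have [T T0 hT] := hlux_coord.
pose pr i (f : heart) : R[i]^o := f i.
have prc i : cvg (pr i @ F).
  apply: complex_complete; apply/cauchyP => e e0.
  have eE : e = (complex.Re e)%:C by rewrite RRe_real// gtr0_real.
  have r0 : 0 < complex.Re e by rewrite -ltcR -eE.
  have d0 : 0 < complex.Re e / T * c%:num by rewrite mulr_gt0// divr_gt0.
  have /cauchyP/(_ (complex.Re e / T * c%:num)%:C) := Fc.
  rewrite ltcR => /(_ d0)[f Ff].
  exists (pr i f); rewrite -[_ _]/(F (pr i @^-1` ball (pr i f) e)).
  apply: filterS Ff => g; rewrite -!ball_normE/= ltr_heart mulfK// => fg.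
  rewrite eE -rnormE ltcR; apply: le_lt_trans (hT (f - g) i) _.
  by rewrite mulrC -ltr_pdivlMr.
pose l : I -> R[i]^o := fun i => lim (pr i @ F).
have key (f : heart) (r : R) : 0 <= r -> F [set g | hlux (f - g) < r] ->
    (lux phi ((f : I -> R[i]^o) - l)%R <= r%:E)%E.
  move=> r0 Fr; apply: lux_fin_le => // s us.
  pose one : I -> R[i]^o := fun i => if i \in s then 1 else 0.
  have fone : finsupp one.
    apply: (@sub_finite_set _ _ [set` s]) => [i /=|]; last exact: finite_seq.
    by rewrite /one; case: ifP => //; rewrite eqxx.
  have oneoo := lux_finsupp phi fone.
  set K := fine (lux phi one); have K0 : 0 <= K.
    by rewrite -lee_fin -fin_luxE// lux_ge0.
  apply/lee_addgt0Pr => e e0.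
  have d0 : 0 < e / (K + 1) by rewrite divr_gt0// ltr_wpDl.
  have Fs : F [set g : heart | forall i, i \in s -> rnorm (l i - g i) < e / (K + 1)].
    elim: s {us one fone oneoo K K0 d0} (e / (K + 1)) d0 => [|i s IHs] d d0.
      by apply: filterS filterT => g _ i.
    have d0C : (0 : R[i]) < d%:C by rewrite ltcR.
    have /cvgrPdist_lt/(_ _ d0C) H1 := prc i.
    apply: filterS2 H1 (IHs d d0) => g H1 H2 j; rewrite inE => /orP[/eqP ->|/H2//].
    by move: H1; rewrite -rnormE ltcR.
  have [g [/= Hg1 Hg2]] := filter_ex (filterI Fr Fs).
  have -> : (fun i => if i \in s then ((f : I -> R[i]^o) - l) i else 0) =
     (fun i => if i \in s then (f - g : heart) i else 0) +
     (fun i => if i \in s then g i - l i else 0).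
    apply/funext => i; rewrite -[RHS]/(_ i + _ i) /=; case: ifP => _; last by rewrite addr0.
    by rewrite -[RHS]/((f i - g i) + (g i - l i)) subrKA.
  rewrite -EFinD; apply: luxD.
    apply: (@le_trans _ _ (lux phi (f - g : heart))).
      by apply: le_lux => i; case: ifP => // _; rewrite rnorm0 rnorm_ge0.
    by rewrite hluxE lee_fin ltW.
  apply: (@le_trans _ _ (lux phi ((e / (K + 1))%:C *: one)%R)).
    apply: le_lux => i; rewrite -[X in _ <= rnorm X]/(_ *: one i) /one.
    rewrite rnormZ rnorm_real (ger0_norm (ltW d0)).
    case: ifPn => [si|_]; last by rewrite !rnorm0 mulr0.
    have -> : rnorm (1 : R[i]^o) = 1 by rewrite /rnorm normr1.
    by rewrite mulr1 -rnormN opprB ltW// Hg2.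
  have := @luxZ R I phi (e / (K + 1))%:C one K.
  rewrite -fin_luxE// lexx rnorm_real (ger0_norm (ltW d0)) => /(_ isT).
  move=> /le_trans; apply; rewrite lee_fin mulrAC ler_pdivrMr ?ltr_wpDl//.
  by rewrite ler_wpM2l ?(ltW e0)// lerDl.
have near (r : R) : 0 < r -> exists2 f : heart, F [set g | hlux (f - g) < r] &
    (lux phi ((f : I -> R[i]^o) - l)%R <= r%:E)%E.
  move=> r0; have d0 : 0 < r * c%:num by rewrite mulr_gt0.
  have /cauchyP/(_ (r * c%:num)%:C) := Fc; rewrite ltcR => /(_ d0)[f Ff].
  have Ff' : F [set g | hlux (f - g) < r].
    by apply: filterS Ff => g; rewrite -ball_normE/= ltr_heart mulfK.
  by exists f => //; apply: key => //; exact: ltW.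
have lH : is_heart l.
  apply/asboolP; split.
    have [f _ fl] := near 1 ltr01.
    have -> : l = (f : I -> R[i]^o) + - ((f : I -> R[i]^o) - l) by rewrite opprB addrC subrK.
    apply: (@le_lt_trans _ _ (hlux f + 1)%:E); last exact: ltry.
    by apply: luxD; rewrite ?luxN// hluxE.
  move=> e e0; have e2 : 0 < e / 2 by rewrite divr_gt0.
  have [f _ fl] := near _ e2.
  have /asboolP[_ /(_ _ e2)[y [fy]]] := heartP f.
  move=> fyl; have fyoo := lt_trans fyl (ltry _).
  rewrite (fin_luxE fyoo) lte_fin in fyl.
  exists y; split=> //.
  have -> : l - y = - ((f : I -> R[i]^o) - l) + ((f : I -> R[i]^o) - y).
    by rewrite opprB subrKA.
  apply: (@le_lt_trans _ _ (e / 2 + fine (lux phi ((f : I -> R[i]^o) - y)))%:E).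
    by apply: luxD; rewrite ?luxN// -fin_luxE.
  by rewrite lte_fin [ltRHS]splitr ltrD2l.
pose L := Heart lH.
apply/cvg_ex; exists L; apply/cvgrPdist_lt => e e0.
have eE : e = (complex.Re e)%:C by rewrite RRe_real// gtr0_real.
have r0 : 0 < complex.Re e by rewrite -ltcR -eE.
set r := complex.Re e / c%:num.
have rgt0 : 0 < r / 2 by rewrite !divr_gt0.
have [f Ff fl] := near _ rgt0.
apply: filterS Ff => g /= fg.
rewrite eE ltr_heart -/r -lte_fin -hluxE.
apply: (@le_lt_trans _ _ (r / 2 + hlux (f - g))%:E); last first.
  by rewrite lte_fin [ltRHS]splitr ltrD2l.
have -> : heart_fun (L - g) = - ((f : I -> R[i]^o) - l) + heart_fun (f - g).
  by apply/funext => i; rewrite opprB -[RHS]/((l i - f i) + (f i - g i)) subrKA.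
by apply: luxD; rewrite ?luxN// hluxE.
Qed.

HB.instance Definition _ := Uniform_isComplete.Build heart heart_complete.

Lemma heart_fun_linear : linear (heart_fun : heart -> (I -> R[i]^o)).
Proof. by []. Qed.

HB.instance Definition _ :=
  GRing.isLinear.Build R[i] heart (I -> R[i]^o) *:%R heart_fun heart_fun_linear.

Context (heart_contractive : forall f i, `|f i| <= `|f|).

Lemma heart_dense : dense [set f : heart | finsupp f].
Proof.
move=> O [f Of] oO.
have /nbhs_ballP[e /= e0 feO] : nbhs f O by apply: open_nbhs_nbhs.
have eE : e = (complex.Re e)%:C by rewrite RRe_real// gtr0_real.
have r0 : 0 < complex.Re e by rewrite -ltcR -eE.
have /asboolP[_ /(_ (complex.Re e / c%:num))] := heartP f.
rewrite divr_gt0// => /(_ isT)[y [fy fyl]].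
exists (Heart (finsupp_heart fy)); split => //; apply: feO.
by rewrite -ball_normE/= eE ltr_heart -lte_fin -hluxE.
Qed.

Lemma heart_solid f x : (forall i, `|x i| <= `|f i|) ->
  exists2 g : heart, heart_fun g = x & `|g| <= `|f|.
Proof.
move=> xf.
have xf' i : rnorm (x i) <= rnorm (f i) by rewrite -lecR !rnormE.
have xH : is_heart x.
  apply/asboolP; split.
    by apply: le_lt_trans (le_lux phi xf') _; rewrite hluxE ltry.
  move=> e e0; have /asboolP[_ /(_ _ e0)[y [fy fyl]]] := heartP f.
  exists (fun i => if y i == 0 then 0 else x i); split.
    by apply: finsupp_sub fy => i /eqP ->.
  apply: le_lt_trans (le_lux phi _) fyl => i.
  rewrite -[X in rnorm X <= _]/(x i - (if y i == 0 then 0 else x i)).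
  rewrite -[X in _ <= rnorm X]/(f i - y i).
  by case: eqP => [->|_]; rewrite ?subr0// subrr rnorm0 rnorm_ge0.
exists (Heart xH) => //.
by rewrite !heart_normE lecR ler_wpM2l// -lee_fin -!hluxE le_lux.
Qed.

Definition orlicz_heart : bsl R I := {|
  bsl_space := heart ;
  bsl_fun := heart_fun ;
  bsl_fun_inj := val_inj ;
  bsl_finsupp := fun x fx => ex_intro2 _ _ (Heart (finsupp_heart fx)) Logic.I erefl ;
  bsl_dense := heart_dense ;
  bsl_solid := heart_solid ;
  bsl_contractive := heart_contractive |}.

End orlicz_heart.

(* Main.v *)
(* Since [C_E] is finite, the norm of [E] is equivalent to the sup norm.  A
   derivation of a summand extends to the sum through the coordinate map, and an
   implementing functional restricts back, which gives the lower bound.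
   Conversely, let [D] be a derivation of the sum and [D_i] its restrictions.
   Weak amenability of the summands makes [D] vanish across distinct summands, so
   testing [D] on finite families of unit vectors, with phases adjusted, gives
   [\sum_i |D_i| <= C_E^2 |D|].  Hence functionals implementing the [D_i] with
   norm at most [w |D_i|] have finite partial sums of norm at most
   [C_E^2 w |D|], and any weak-star limit point of these implements [D].
   That weak amenability alone bounds [WAM] is an open-mapping argument. *)

Require Import Defs.
From mathcomp Require Import all_boot all_order all_algebra.
From mathcomp Require Import all_classical all_reals all_analysis.
From mathcomp Require Import complex ring.

Set Implicit Arguments.
Unset Strict Implicit.

Import Order.TTheory GRing.Theory Num.Theory numFieldNormedType.Exports.

Local Open Scope classical_set_scope.
Local Open Scope complex_scope.
Local Open Scope ring_scope.

(** * Limits of bounded scalar functions along ultrafilters *)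

Section ultralimits.
Context (R : realType) (T : Type) (U : set_system T) {UU : UltraFilter U}.

Lemma ultra_fmap (S : Type) (f : T -> S) : UltraFilter (f @ U).
Proof.
split=> [|G PG UG]; first exact: fmap_proper_filter.
apply/seteqP; split=> // A GA.
have [//|nA] := in_ultra_setVsetC (f @^-1` A) UU.
have GnA : G (~` A) by apply: UG.
by have [x []] := filter_ex (filterI GA GnA).
Qed.

(** Compactness of the segment from [- M] to [M], which belongs to the image ultrafilter. *)
Lemma ultra_bounded_cvg (f : T -> R) (M : R) :
  (forall t, `|f t| <= M) -> cvg (f @ U).
Proof.
move=> fM; have := @segment_compact R (- M) M; rewrite compact_ultra.
move=> /(_ _ (ultra_fmap f))[|x [_ fx]]; last by apply/cvg_ex; exists x.
apply: (@filterS _ U _ setT) filterT => t _.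
by rewrite /= in_itv/= -ler_norml.
Qed.

Lemma ultra_bounded_cvgC (f : T -> R[i]^o) (M : R) :
  (forall t, rnorm (f t) <= M) -> cvg (f @ U).
Proof.
move=> fM; apply: complex_complete; apply/cauchyP => e e0.
have eE : e = (complex.Re e)%:C by rewrite RRe_real// gtr0_real.
have r2 : 0 < complex.Re e / 2 by rewrite divr_gt0// -ltcR -eE.
have /cvg_ex[a aP] : cvg ((fun t => complex.Re (f t)) @ U).
  apply: (@ultra_bounded_cvg _ M) => t; apply: le_trans (fM t).
  by rewrite -lecR rnormE normc_ge_Re.
have /cvg_ex[b bP] : cvg ((fun t => complex.Im (f t)) @ U).
  apply: (@ultra_bounded_cvg _ M) => t; apply: le_trans (fM t).
  (* The imaginary part of [z] is, up to sign, the real part of ['i * z]. *)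
  rewrite -lecR -[rnorm _]mul1r -(rnormi R) -rnormM rnormE.
  apply: le_trans (normc_ge_Re _).
  by case: (f t) => u v /=; rewrite mul0r mul1r add0r normrN.
exists (a +i* b).
have /cvgrPdist_lt/(_ _ r2) H1 := aP; have /cvgrPdist_lt/(_ _ r2) H2 := bP.
rewrite -[_ _]/(U (f @^-1` ball (a +i* b : R[i]^o) e)).
apply: filterS2 H1 H2 => t at_ bt; rewrite -ball_normE/= eE -rnormE ltcR.
have -> : (a +i* b : R[i]) - f t =
    (a - complex.Re (f t))%:C + 'i * (b - complex.Im (f t))%:C.
  by case: (f t) => c d; simpc.
rewrite (le_lt_trans (rnormD _ _))// rnormM !rnorm_real.
by rewrite rnormi mul1r [ltRHS]splitr ltrD.
Qed.

End ultralimits.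

Lemma cvgC_rnorm_le (R : realType) (T : Type) (F : set_system T)
    {FF : ProperFilter F} (f : T -> R[i]^o) (l : R[i]^o) (M : R) :
  f @ F --> l -> (\forall t \near F, rnorm (f t) <= M) -> rnorm l <= M.
Proof.
move=> fl fM; apply/ler_addgt0Pr => e e0.
have e0C : (0 : R[i]) < e%:C by rewrite ltcR.
have /cvgrPdist_lt/(_ _ e0C) fle := fl.
have [t [/= lt_ ft]] := filter_ex (filterI fle fM).
rewrite -(subrK (f t) l) addrC; apply: le_trans (rnormD _ _) _.
by rewrite lerD// ltW// -ltcR rnormE.
Qed.

Lemma cvgC_rnormP (R : realType) (T : Type) (F : set_system T)
    {FF : Filter F} (f : T -> R[i]^o) (l : R[i]^o) :
  (forall e : R, 0 < e -> \forall t \near F, rnorm (l - f t) <= e) ->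
  f @ F --> l.
Proof.
move=> fl; apply/cvgrPdist_le => e e0.
have eE : e = (complex.Re e)%:C by rewrite RRe_real// gtr0_real.
have r0 : 0 < complex.Re e by rewrite -ltcR -eE.
by apply: filterS (fl _ r0) => t; rewrite eE -rnormE lecR.
Qed.

(** * Bounded functionals and their weak-star limits *)

Section dual_elements.
Context (R : realType) (V : normedModType R[i]).
Implicit Types (phi psi : dual V) (x y : V).

Lemma dual_le phi x : rnorm (phi x) <= rnorm phi * rnorm x.
Proof. exact: rnorm_opnorm (dual_linear phi) (dual_bounded phi). Qed.

Lemma dual_lin phi (k : R[i]) x y : phi (k *: x + y) = k * phi x + phi y.
Proof. by rewrite linearP. Qed.

Lemma dual0 phi : phi 0 = 0.
Proof. exact: linear0. Qed.

Lemma dual_ext phi psi : (forall x, phi x = psi x) -> phi = psi.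
Proof. by move=> e; apply/val_inj/funext. Qed.

Lemma opnorm_leM (W : normedModType R[i]) (f : V -> W) (M : R) : 0 <= M ->
  (forall x, rnorm (f x) <= M * rnorm x) -> opnorm f <= M.
Proof.
move=> M0 fM; apply: opnorm_le => x x1; apply: le_trans (fM x) _.
by rewrite ler_piMr.
Qed.

Lemma mk_dual (f : V -> R[i]^o) (M : R) : 0 <= M -> linear f ->
    (forall x, rnorm (f x) <= M * rnorm x) ->
  exists2 phi : dual V, rnorm phi <= M & forall x, phi x = f x.
Proof.
move=> M0 lf fM.
have df : is_dual f by apply/asboolP; split => //; exists M.
by exists (Dual df) => //; rewrite dual_normE; exact: opnorm_leM.
Qed.

(* Weak-star compactness of balls of the dual, along an ultrafilter. *)
Lemma dual_ultralimit (T : Type) (U : set_system T) {UU : UltraFilter U}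
    (phi : T -> dual V) (M : R) : 0 <= M -> (forall t, rnorm (phi t) <= M) ->
  exists2 psi : dual V, rnorm psi <= M &
    forall x, phi t x @[t --> U] --> psi x.
Proof.
move=> M0 phiM.
have phixM x t : rnorm (phi t x) <= M * rnorm x.
  by apply: le_trans (dual_le _ _) _; rewrite ler_wpM2r ?rnorm_ge0.
have phic x : phi t x @[t --> U] --> lim (phi t x @[t --> U]).
  exact: ultra_bounded_cvgC (phixM x).
have [||psi psiM psiE] := @mk_dual (fun x => lim (phi t x @[t --> U])) M M0.
- move=> k x y; apply: cvg_lim; first exact: norm_hausdorff.
  rewrite (_ : (fun t => _) = (fun t => k *: (phi t x : R[i]^o) + phi t y)).
    by apply: cvgD; [apply: cvgZl_tmp; exact: phic|exact: phic].
  by apply/funext => t; rewrite dual_lin.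
- by move=> x; apply: cvgC_rnorm_le (phic x) _; apply: filterS filterT => t _.
exists psi; first exact: psiM.
by move=> x; rewrite psiE; exact: phic.
Qed.

End dual_elements.

(** * Derivations as bilinear forms, and their implementation *)

Section derivations.
Context (R : realType) (A : banachAlgType R[i]).
Implicit Types (D : A -> dual A) (phi : dual A) (a x : A).

Lemma bmul0l a : 0 ** a = 0.
Proof. by have := bscalerAl 0 0 a; rewrite !scale0r. Qed.

Lemma bmul0r a : a ** 0 = 0.
Proof. by have := bscalerAr 0 a 0; rewrite !scale0r. Qed.

Lemma adE phi a x : ad phi a x = phi (x ** a) - phi (a ** x).
Proof. by []. Qed.

Lemma eq_adP D phi :
  (forall a x, D a x = phi (x ** a) - phi (a ** x)) -> D = ad phi.
Proof. by move=> e; apply/funext => a; apply: dual_ext => x; exact: e. Qed.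

Lemma form_le D a x : bounded_derivation D ->
  rnorm (D a x) <= opnorm D * (rnorm a * rnorm x).
Proof.
move=> [lD bD _]; apply: le_trans (dual_le _ _) _.
by rewrite mulrA ler_wpM2r ?rnorm_ge0// rnorm_opnorm.
Qed.

Lemma opnorm_form_le D (M : R) : 0 <= M ->
  (forall a x, rnorm (D a x) <= M * (rnorm a * rnorm x)) -> opnorm D <= M.
Proof.
move=> M0 DM; apply: opnorm_leM => // a; apply: opnorm_leM => [|x].
  by rewrite mulr_ge0 ?rnorm_ge0.
by rewrite -mulrA; exact: DM.
Qed.

Lemma derivationM D a b x : bounded_derivation D ->
  D (a ** b) x = D b (x ** a) + D a (b ** x).
Proof. by move=> [_ _ /(_ a b) ->]. Qed.

Lemma derivation_lin D k a b x : bounded_derivation D ->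
  D (k *: a + b) x = k * D a x + D b x.
Proof. by move=> [/(_ k a b) -> _ _]. Qed.

Lemma derivation_sum D (J : Type) (s : seq J) (F : J -> A) x :
  bounded_derivation D -> D (\sum_(j <- s) F j) x = \sum_(j <- s) D (F j) x.
Proof.
move=> dD; elim: s => [|j s IHs].
  rewrite !big_nil; have := derivation_lin (-1) 0 0 x dD.
  by rewrite scaler0 addr0 mulN1r addNr.
by rewrite !big_cons -IHs -[F j]scale1r derivation_lin// mul1r scale1r.
Qed.

(** Reduces the construction of a derivation to scalar identities and one bound on a bilinear
    form. *)
Lemma mk_derivation (B : A -> A -> R[i]^o) (M : R) : 0 <= M ->
    (forall k a b x, B (k *: a + b) x = k * B a x + B b x) ->
    (forall k a x y, B a (k *: x + y) = k * B a x + B a y) ->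
    (forall a x, rnorm (B a x) <= M * (rnorm a * rnorm x)) ->
    (forall a b x, B (a ** b) x = B b (x ** a) + B a (b ** x)) ->
  exists D, [/\ bounded_derivation D, opnorm D <= M & forall a x, D a x = B a x].
Proof.
move=> M0 Bl Br BM Bd.
have /choice[D DP] a : exists phi : dual A, forall x, phi x = B a x.
  have [|||phi _ phiE] := @mk_dual _ _ (B a) (M * rnorm a); last by exists phi.
  - by rewrite mulr_ge0 ?rnorm_ge0.
  - by move=> k x y; exact: Br.
  - by move=> x; rewrite -mulrA; exact: BM.
exists D; split; last exact: DP.
- split=> [k a b||a b].
  + by apply: dual_ext => x; rewrite -[RHS]/(k * D a x + D b x) !DP Bl.
  + exists M => a; apply: opnorm_leM => [|x]; first by rewrite mulr_ge0 ?rnorm_ge0.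
    by rewrite DP -mulrA; exact: BM.
  + by apply: dual_ext => x; rewrite -[RHS]/(D b (x ** a) + D a (b ** x)) !DP.
- by apply: opnorm_form_le => // a x; rewrite DP.
Qed.

Lemma ad_derivation phi : bounded_derivation (ad phi).
Proof.
have [|||||D [dD _ DE]] := @mk_derivation (ad phi) (rnorm phi + rnorm phi).
- by rewrite addr_ge0 ?rnorm_ge0.
- move=> k a b x; rewrite !adE bmulDr bmulDl bscalerAl bscalerAr !dual_lin.
  by rewrite mulrBr opprD addrACA.
- by move=> k a x y; rewrite dual_lin.
- move=> a x; rewrite adE; apply: le_trans (rnormD _ _) _; rewrite rnormN mulrDl.
  apply: lerD; apply: le_trans (dual_le _ _) _; rewrite ler_wpM2l ?rnorm_ge0//.
    by rewrite mulrC rnorm_bmul.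
  exact: rnorm_bmul.
- by move=> a b x; rewrite !adE !bmulA addrA subrK.
by rewrite -(_ : D = ad phi)//; apply: eq_adP => a x; rewrite DE.
Qed.

Lemma bounded_derivation_comb (c d : R[i]) D D' :
  bounded_derivation D -> bounded_derivation D' ->
  exists D'', [/\ bounded_derivation D'',
    opnorm D'' <= rnorm c * opnorm D + rnorm d * opnorm D' &
    forall a x, D'' a x = c * D a x + d * D' a x].
Proof.
move=> hD hD'; apply: mk_derivation.
- by rewrite addr_ge0// mulr_ge0 ?rnorm_ge0// opnorm_ge0//; case: hD hD' => [_ ? _] [].
- move=> k a b x; rewrite !derivation_lin// !mulrDr (mulrCA c k) (mulrCA d k).
  by rewrite addrACA.
- move=> k a x y; rewrite !dual_lin !mulrDr (mulrCA c k) (mulrCA d k).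
  by rewrite addrACA.
- move=> a x; apply: le_trans (rnormD _ _) _; rewrite !rnormM mulrDl -!mulrA.
  by rewrite lerD// ler_wpM2l ?rnorm_ge0// form_le.
- by move=> a b x; rewrite !derivationM// !mulrDr addrACA.
Qed.

(** The bound [K] is absolute rather than a multiple of [opnorm D]; for fixed [K] the condition is
    then closed under limits of [D]. *)
Definition inner_le D (K : R) := exists phi, D = ad phi /\ rnorm phi <= K.

Lemma inner_leB D D' D'' (K K' : R) : inner_le D K -> inner_le D' K' ->
  (forall a x, D'' a x = D a x - D' a x) -> inner_le D'' (K + K').
Proof.
move=> [phi [-> phiK]] [psi [-> psiK]] DE; exists (phi - psi); split.
  apply: eq_adP => a x; rewrite DE !adE.
  by rewrite -![(phi - psi) _]/(phi _ - psi _) !opprD !opprK addrACA.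
by apply: le_trans (rnormD _ _) _; rewrite rnormN lerD.
Qed.

Lemma inner_leZ D D' (k K : R) : inner_le D K ->
  (forall a x, D' a x = k%:C * D a x) -> inner_le D' (`|k| * K).
Proof.
move=> [phi [-> phiK]] DE; exists (k%:C *: phi); split.
  apply: eq_adP => a x; rewrite DE adE.
  by rewrite -![(k%:C *: phi) _]/(k%:C * phi _) mulrBr.
by rewrite rnormZ rnorm_real ler_wpM2l.
Qed.

(** Functionals implementing better and better approximations stay in one ball; a weak-star limit of
    them implements [D]. *)
Lemma inner_le_closed D (K : R) : 0 <= K ->
  (forall e : R, 0 < e -> exists D', inner_le D' K /\
     forall a x, rnorm (D a x - D' a x) <= e * (rnorm a * rnorm x)) ->
  inner_le D K.
Proof.
move=> K0 h.
have /choice[Dn DnP] (n : nat) : exists phi : dual A, rnorm phi <= K /\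
    forall a x, rnorm (D a x - (phi (x ** a) - phi (a ** x))) <=
      n.+1%:R^-1 * (rnorm a * rnorm x).
  by have [|D' [[phi [-> phiK]] D'e]] := h n.+1%:R^-1; last exists phi.
have [U [UU Uoo]] := ultraFilterLemma (@eventually_filter).
have [|phi phiK phiE] := @dual_ultralimit _ _ _ U _ Dn K K0.
  by move=> n; have [] := DnP n.
exists phi; split=> //; apply: eq_adP => a x.
have c1 : Dn n (x ** a) - Dn n (a ** x) @[n --> U] -->
    (phi (x ** a) - phi (a ** x) : R[i]^o).
  by apply: cvgB; exact: phiE.
rewrite -(cvg_lim (@norm_hausdorff _ R[i]^o) c1); apply/esym.
apply: (cvg_lim (@norm_hausdorff _ R[i]^o)).
apply: cvgC_rnormP => e e0; apply: Uoo.
(* Adding [1] keeps the divisor positive when [a] or [x] is zero. *)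
have C0 : 0 < rnorm a * rnorm x + 1 by rewrite ltr_wpDl ?mulr_ge0 ?rnorm_ge0.
have : 0 < e / (rnorm a * rnorm x + 1) by rewrite divr_gt0.
move=> d0; apply: filterS (near_infty_natSinv_lt (PosNum d0)) => n /= ne.
have [_ /(_ a x)/le_trans] := DnP n; apply.
apply: (@le_trans _ _ (e / (rnorm a * rnorm x + 1) * (rnorm a * rnorm x))).
  by rewrite ler_wpM2r ?mulr_ge0 ?rnorm_ge0// ltW.
by rewrite mulrAC ler_pdivrMr// ler_wpM2l ?lerDl// ltW.
Qed.

End derivations.

(** * The weak amenability constant *)

Section weak_amenability_constant.
Context (R : realType) (A : banachAlgType R[i]).
Implicit Types (D : A -> dual A) (phi : dual A) (a x y : A).

Lemma WAM_ge0 : (0 <= WAM A)%E.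
Proof. by apply: le_ereal_inf_tmp => _ [C [C0 _] <-]; rewrite lee_fin. Qed.

Lemma WAM_le (C : R) : 0 <= C ->
  (forall D, bounded_derivation D -> inner_le D (C * opnorm D)) ->
  (WAM A <= C%:E)%E.
Proof. by move=> C0 h; apply: ereal_inf_lbound; exists C. Qed.

Lemma WAM_lt D (C : R) : (WAM A < C%:E)%E -> bounded_derivation D ->
  inner_le D (C * opnorm D).
Proof.
move=> /ereal_inf_lt[_ [K [K0 h] <-]]; rewrite lte_fin => KC dD.
have [phi [Dphi phiK]] := h D dD; exists phi; split=> //.
apply: le_trans phiK _; rewrite ler_wpM2r ?(ltW KC)//.
by apply: opnorm_ge0; case: dD.
Qed.

Lemma WAM_lty_weakly_amenable : (WAM A < +oo)%E -> weakly_amenable A.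
Proof.
move=> Aoo D dD; have [||phi [-> _]] := @WAM_lt D (fine (WAM A) + 1); last by exists phi.
  have Afin : (WAM A) \is a fin_num by rewrite ge0_fin_numE// WAM_ge0.
  by rewrite EFinD fineK// lteDl.
exact: dD.
Qed.

(** A derivation defeating the constant [K / r], rescaled to norm [r], defeats the absolute bound
    [K]. *)
Lemma small_derivation_not_inner_le :
  (forall K : R, 0 <= K ->
     exists D, bounded_derivation D /\ ~ inner_le D (K * opnorm D)) ->
  forall K r : R, 0 <= K -> 0 < r ->
    exists D, [/\ bounded_derivation D, opnorm D <= r & ~ inner_le D K].
Proof.
move=> h K r K0 r0; have [|D [dD nD]] := h (K / r); first by rewrite divr_ge0// ltW.
have [d0|d0] := eqVneq (opnorm D) 0.
  (* A derivation of norm zero is implemented by the zero functional. *)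
  exfalso; apply: nD; rewrite d0 mulr0; exists 0; rewrite rnorm0; split=> //.
  apply: eq_adP => a x; rewrite subrr; apply/rnorm0_eq0/le_anti.
  by rewrite rnorm_ge0 andbT; have := form_le a x dD; rewrite d0 mul0r.
have dgt0 : 0 < opnorm D by rewrite lt_def d0 opnorm_ge0//; case: dD.
have [D' [dD' D'le D'E]] := bounded_derivation_comb (r / opnorm D)%:C 0 dD dD.
exists D'; split=> //.
  apply: le_trans D'le _; rewrite rnorm0 mul0r addr0 rnorm_real.
  by rewrite ger0_norm ?divfK// divr_ge0// ltW.
move=> D'K; apply: nD.
rewrite (_ : K / r * opnorm D = `|opnorm D / r| * K); last first.
  by rewrite ger0_norm ?divr_ge0 ?(ltW r0) ?(ltW dgt0)//; ring.
apply: (inner_leZ D'K) => a x.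
rewrite D'E mul0r addr0 mulrA -rmorphM/= (_ : opnorm D / r * _ = 1) ?mul1r//.
by field; rewrite d0 gt_eqF.
Qed.

End weak_amenability_constant.

(** * Pointwise limits of derivations, and finiteness of the constant *)

Lemma cvgC_unique (R : realType) (T : Type) (F : set_system T)
    {FF : ProperFilter F} (f g : T -> R[i]^o) (l m : R[i]^o) :
  f @ F --> l -> g @ F --> m -> (forall t, f t = g t) -> l = m.
Proof.
move=> fl gm /funext fg; rewrite fg in fl.
rewrite -(cvg_lim (@norm_hausdorff _ R[i]^o) fl).
apply: (cvg_lim (@norm_hausdorff _ R[i]^o)); exact: gm.
Qed.

Section derivation_limits.
Context (R : realType) (A : banachAlgType R[i]).
Implicit Types (D : A -> dual A) (phi : dual A) (a b x y : A).

(** The uniform bound provides the limits; each identity involves finitely many values and so passes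
    to the limit. *)
Lemma derivation_ultralimit (T : Type) (U : set_system T) {UU : UltraFilter U}
    (D : T -> A -> dual A) (M : R) : 0 <= M ->
    (forall t, bounded_derivation (D t)) ->
    (forall t a x, rnorm (D t a x) <= M * (rnorm a * rnorm x)) ->
  exists2 D', bounded_derivation D' &
    forall a x, D t a x @[t --> U] --> D' a x.
Proof.
move=> M0 dD DM.
have /choice[L LD] a : exists psi : dual A,
    forall x, D t a x @[t --> U] --> psi x.
  have [||psi _ psiE] := @dual_ultralimit _ _ _ U _ (fun t => D t a) (M * rnorm a).
  - by rewrite mulr_ge0 ?rnorm_ge0.
  - move=> t; apply: opnorm_leM => [|x]; first by rewrite mulr_ge0 ?rnorm_ge0.
    by rewrite -mulrA; exact: DM.
  - by exists psi; exact: psiE.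
have [D' [dD' _ D'E]] : exists D', [/\ bounded_derivation D', opnorm D' <= M &
    forall a x, D' a x = L a x].
  apply: mk_derivation => [//|k a b x|k a x y|a x|a b x].
  - apply: (@cvgC_unique _ _ U _ _ (fun t => k *: (D t a x : R[i]^o) + D t b x)).
    + exact: LD.
    + by apply: cvgD; [apply: cvgZl_tmp; exact: LD|exact: LD].
    + by move=> t /=; rewrite derivation_lin.
  - exact: dual_lin.
  - by apply: cvgC_rnorm_le (LD a x) _; apply: filterS filterT => t _; exact: DM.
  - apply: (@cvgC_unique _ _ U _ _ (fun t => D t b (x ** a) + D t a (b ** x))).
    + exact: LD.
    + by apply: cvgD; exact: LD.
    + by move=> t /=; rewrite derivationM.
by exists D' => [//|a x]; rewrite D'E; exact: LD.
Qed.

(* An open-mapping argument by nested balls: since the derivations which are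
   implemented with norm at most n form a closed set, a derivation lying outside
   of it is the centre of a ball avoiding it. *)
Theorem weakly_amenable_WAM_lty : weakly_amenable A -> (WAM A < +oo)%E.
Proof.
move=> wA; rewrite ltNge leye_eq; apply/negP => /eqP Aoo.
have /small_derivation_not_inner_le small (K : R) : 0 <= K ->
    exists D, bounded_derivation D /\ ~ inner_le D (K * opnorm D).
  move=> K0; apply: contrapT => h.
  suff : (WAM A <= K%:E)%E by rewrite Aoo.
  apply: WAM_le => // D dD; apply: contrapT => nD.
  by apply: h; exists D.
pose close D D' (r : R) :=
  forall a x, rnorm (D a x - D' a x) <= r * (rnorm a * rnorm x).
(* A state is a ball: its centre, its radius, and the norm bound to be excluded by the next ball. *)
pose state := {p : (A -> dual A) * R * nat | bounded_derivation p.1.1 /\ 0 < p.1.2}.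
pose dr (s : state) := (sval s).1.1; pose rd (s : state) := (sval s).1.2.
pose nb (s : state) := (sval s).2.
have rd0 s : 0 < rd s by case: s => [[[? ?] ?] []].
have drd s : bounded_derivation (dr s) by case: s => [[[? ?] ?] []].
(* The centre moves by at most half the old radius and the radius is at least halved, so the balls
   are nested. *)
pose next (s t : state) := [/\ nb t = (nb s).+1, rd t <= rd s / 2,
  close (dr t) (dr s) (rd s / 2) &
  forall D, close D (dr t) (rd t) -> ~ inner_le D (nb s)%:R].
have step s : {t | next s t}.
  apply: cid; have [phi phiE] := wA _ (drd s).
  have r2 : 0 < rd s / 2 by rewrite divr_gt0.
  (* If [dr s + D] were implemented with norm at most [nb s], subtracting [phi] would implement [D]
     with norm at most [nb s] plus [rnorm phi]. *)
  have [|D [dD Dle nD]] := small ((nb s)%:R + rnorm phi) (rd s / 2) _ r2.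
    by rewrite addr_ge0 ?rnorm_ge0.
  have [D' [dD' _ D'E]] := bounded_derivation_comb 1 1 (drd s) dD.
  have nD' : ~ inner_le D' (nb s)%:R.
    move=> D'n; apply: nD; apply: (inner_leB D'n (D' := dr s)).
      by exists phi; rewrite lexx.
    by move=> a x; rewrite D'E !mul1r addrAC subrr add0r.
  (* Otherwise maps implemented within [nb s] would come arbitrarily close to [D'], and [D'] would
     be implemented within [nb s] too. *)
  have [r [r0 rP]] : exists r : R, 0 < r /\
      forall D, close D D' r -> ~ inner_le D (nb s)%:R.
    apply: contrapT => h; apply: nD'; apply: inner_le_closed => // e e0.
    apply: contrapT => h'; apply: h; exists e; split=> // D1 D1D' D1n; apply: h'.
    by exists D1; split=> // a x; rewrite -rnormN opprB.
  pose r' := Num.min r (rd s / 2).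
  have r'0 : 0 < r' by rewrite lt_min r0.
  pose t : state := exist _ (D', r', (nb s).+1) (conj dD' r'0).
  exists t; split=> //.
  - by rewrite /rd/= ge_min lexx orbT.
  - move=> a x; rewrite [dr t]/= /dr/= D'E !mul1r addrAC subrr add0r.
    apply: le_trans (form_le _ _ dD) _.
    by rewrite ler_wpM2r// mulr_ge0 ?rnorm_ge0.
  - move=> D1 D1t; apply: rP => a x; apply: le_trans (D1t a x) _.
    by rewrite ler_wpM2r ?mulr_ge0 ?rnorm_ge0// /rd/= ge_min lexx.
pose s0 : state := exist _ (ad 0, 1, 0%N) (conj (ad_derivation 0) ltr01).
have [s [_ sP]] := dependent_choice step s0.
(* With [n] general, the induction hypothesis at [n.+1] accounts for one half of the radius and the
   first step for the other. *)
have sclose k : forall n, close (dr (s (n + k)%N)) (dr (s n)) (rd (s n)).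
  elim: k => [n a x|k IH n a x].
    by rewrite addn0 subrr rnorm0 !mulr_ge0 ?rnorm_ge0// ltW.
  have [_ rn cn _] := sP n.
  rewrite addnS -addSn -(subrKA (dr (s n.+1) a x)).
  apply: le_trans (rnormD _ _) _.
  rewrite [rd (s n)]splitr mulrDl lerD//; apply: le_trans (IH n.+1 a x) _.
  by rewrite ler_wpM2r ?mulr_ge0 ?rnorm_ge0.
have [U [UU Uoo]] := ultraFilterLemma (@eventually_filter).
have [|||D dD DE] := @derivation_ultralimit _ U _ (fun n => dr (s n))
    (rd (s 0%N) + opnorm (dr (s 0%N))).
- by rewrite addr_ge0 ?(ltW (rd0 _))// opnorm_ge0//; case: (drd (s 0%N)).
- by move=> n; exact: drd.
- move=> n a x /=; rewrite -(subrK (dr (s 0%N) a x) (dr (s n) a x)) mulrDl.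
  by apply: le_trans (rnormD _ _) _; rewrite lerD ?form_le// (sclose n 0%N).
have Dclose n : close D (dr (s n)) (rd (s n)).
  move=> a x; apply: (@cvgC_rnorm_le _ _ U _ (fun m => dr (s m) a x - dr (s n) a x)).
    by apply: cvgB; [exact: DE|exact: cvg_cst].
  by apply: Uoo; exists n => // m /= nm; rewrite -(subnKC nm); exact: sclose.
have nbE n : nb (s n) = (nb (s 0%N) + n)%N.
  by elim: n => [|n IHn]; [rewrite addn0|have [-> _ _ _] := sP n; rewrite IHn addnS].
have [phi phiE] := wA _ dD.
(* The limit lies in every ball, and the bound excluded at step [n] is at least [n], which exceeds
   [rnorm phi]. *)
pose n := (Num.truncn (rnorm phi)).+1.
have [_ _ _ /(_ D (Dclose _))] := sP n; apply.
exists phi; split=> //; rewrite nbE.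
apply: (@le_trans _ _ n%:R); last by rewrite ler_nat leq_addl.
by rewrite ltW// truncnS_gt.
Qed.

End derivation_limits.

(** * Embedding the summands into the sum *)

Section Esum_embeddings.
Context (R : realType) (I : choiceType) (E : bsl R I) (A : I -> banachAlgType R[i]).
Local Notation S := (Esum E A).

Definition chi_norm (F : set I) : R := rnorm (bsl_of E \1_F).

Lemma bsl_of_indicE (F : set I) i : finite_set F ->
  bsl_fun E (bsl_of E \1_F) i = \1_F i.
Proof.
move=> finF; rewrite bsl_ofK//; apply: bsl_finsupp.
apply: (sub_finite_set _ finF) => j /=; rewrite indicE.
by case: (boolP (j \in F)) => [/set_mem//|_]; rewrite eqxx.
Qed.

Lemma chi_norm_ge1 (i : I) : 1 <= chi_norm [set i].
Proof.
rewrite -lecR rnormE; apply: le_trans (bsl_contractive _ i).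
by rewrite bsl_of_indicE// indicE mem_set// normr1.
Qed.

Lemma chi_norm_le (F : set I) : finite_set F -> ((chi_norm F)%:E <= bsl_C E)%E.
Proof. by move=> finF; apply: ereal_sup_ubound; exists F. Qed.

(** By solidity: [M] times the indicator of [F] dominates the norm sequence of [a]. *)
Lemma Esum_norm_le_chi (a : S) (F : set I) (M : R) : finite_set F -> 0 <= M ->
  (forall i, ~ F i -> a i = 0) -> (forall i, F i -> rnorm (a i) <= M) ->
  rnorm a <= M * chi_norm F.
Proof.
move=> finF M0 a0 aM.
rewrite /chi_norm -{1}[M](ger0_norm M0) -rnorm_real -rnormZ -lecR !rnormE.
rewrite Esum_normE; apply: ler_bsl_norm => i.
rewrite bsl_funZ Esum_normsE bsl_of_indicE// normr_id normrM indicE.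
have [Fi|nFi] := pselect (F i).
  by rewrite mem_set// normr1 mulr1 -!rnormE rnorm_real ger0_norm// lecR aM.
by rewrite (a0 _ nFi) normr0 mulr_ge0.
Qed.

Lemma Esum_inj_subproof i (u : A i) :
  is_Esum E (eqtype.dfwith (fun j => 0 : A j) u : families A).
Proof.
apply/asboolP/bsl_finsupp; apply: (sub_finite_set _ (finite_set1 i)) => j /=.
by rewrite /norms; case: eqtype.dfwithP => // k _; rewrite normr0 eqxx.
Qed.

Definition Esum_inj i (u : A i) : S := MkEsum (@Esum_inj_subproof i u).
Arguments Esum_inj {i} u.

Lemma Esum_injE i (u : A i) : Esum_inj u i = u.
Proof. exact: eqtype.dfwith_in. Qed.

Lemma Esum_inj_out i (u : A i) j : i != j -> Esum_inj u j = 0.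
Proof. exact: eqtype.dfwith_out. Qed.

Lemma Esum_inj_lin i k (u v : A i) :
  Esum_inj (k *: u + v) = k *: Esum_inj u + Esum_inj v.
Proof.
apply: Esum_eqP => j; rewrite Esum_addE Esum_scaleE.
have [<-|ij] := eqVneq i j; first by rewrite !Esum_injE.
by rewrite !Esum_inj_out// scaler0 addr0.
Qed.

Lemma Esum_injZ i k (u : A i) : Esum_inj (k *: u) = k *: Esum_inj u.
Proof.
apply: Esum_eqP => j; rewrite Esum_scaleE.
have [<-|ij] := eqVneq i j; first by rewrite !Esum_injE.
by rewrite !Esum_inj_out// scaler0.
Qed.

Lemma Esum_injM i (u v : A i) : Esum_inj (u ** v) = Esum_inj u ** Esum_inj v.
Proof.
apply: Esum_eqP => j; rewrite Esum_mulE.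
have [<-|ij] := eqVneq i j; first by rewrite !Esum_injE.
by rewrite !Esum_inj_out// bmul0l.
Qed.

Lemma Esum_inj_mul0 i j (u : A i) (v : A j) : i != j ->
  Esum_inj u ** Esum_inj v = 0.
Proof.
move=> ij; apply: Esum_eqP => k; rewrite Esum_mulE Esum_zeroE.
have [<-|ik] := eqVneq i k.
  by rewrite (@Esum_inj_out j v) 1?eq_sym// bmul0r.
by rewrite (@Esum_inj_out i u)// bmul0l.
Qed.

Lemma rnorm_Esum_inj i (u : A i) :
  rnorm (Esum_inj u) <= rnorm u * chi_norm [set i].
Proof.
apply: Esum_norm_le_chi; rewrite ?rnorm_ge0//.
  by move=> j ij; rewrite Esum_inj_out//; apply/eqP => ji; apply: ij.
by move=> _ ->; rewrite Esum_injE.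
Qed.

Lemma rnorm_Esum_coord (a : S) i : rnorm (a i) <= rnorm a.
Proof. by rewrite -lecR !rnormE Esum_coord_norm. Qed.

Lemma Esum_inj_sumE (s : seq I) (f : forall i, A i) j : uniq s ->
  (\sum_(i <- s) Esum_inj (f i) : S) j = if j \in s then f j else 0.
Proof.
elim: s => [_|i s IHs /= /andP[si us]]; first by rewrite big_nil Esum_zeroE.
rewrite big_cons Esum_addE IHs// inE eq_sym.
have [<-|ij] := eqVneq i j; first by rewrite Esum_injE (negPf si) addr0.
by rewrite Esum_inj_out// add0r.
Qed.

(** Let [f] be a finitely supported approximant in [E] of the norm sequence of [a]. Cutting [a] down
    to the support of [f] leaves, in each coordinate, an error no larger than that of [f]. *)
Lemma Esum_inj_dense (a : S) (e : R) : 0 < e ->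
  exists s : seq I, rnorm (a - \sum_(i <- s) Esum_inj (a i)) < e.
Proof.
move=> e0; have e0C : (0 : R[i]) < e%:C by rewrite ltcR.
have [f [ff fa]] : [set f | finsupp (bsl_fun E f)] `&` ball (Esum_norms a) e%:C !=set0.
  rewrite setIC; apply: bsl_dense.
    by exists (Esum_norms a); exact: ballxx.
  exact: ball_open.
have /finite_seqP[s0 fs] := ff; exists (undup s0).
rewrite -ltcR rnormE; move: fa; rewrite -ball_normE/=; apply: le_lt_trans.
rewrite Esum_normE; apply: ler_bsl_norm => i.
rewrite Esum_normsE bsl_funB Esum_normsE Esum_addE Esum_oppE.
rewrite Esum_inj_sumE ?undup_uniq// mem_undup normr_id.
(* On the support the truncation is exact; off it both errors equal the norm of [a i]. *)
case: ifPn => si; first by rewrite subrr normr0.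
have -> : bsl_fun E f i = 0; last by rewrite !subr0 normr_id.
apply/eqP/negPn/negP => fi; move/negP: si; apply.
by have : [set i | bsl_fun E f i != 0] i by []; rewrite fs.
Qed.

Lemma dual_Esum_eq0 (phi : dual S) :
  (forall i (u : A i), phi (Esum_inj u) = 0) -> phi = 0.
Proof.
move=> phi0; apply: dual_ext => a; apply/rnorm0_eq0/le_anti.
rewrite rnorm_ge0 andbT; apply/ler_addgt0Pr => e e0; rewrite add0r.
have phi1 : 0 < rnorm phi + 1 by rewrite ltr_wpDl ?rnorm_ge0.
have [s sa] := Esum_inj_dense a (divr_gt0 e0 phi1).
have -> : phi a = phi (a - \sum_(i <- s) Esum_inj (a i)).
  by rewrite linearB linear_sum big1 ?subr0// => i _; exact: phi0.
apply: le_trans (dual_le _ _) _.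
apply: (@le_trans _ _ (rnorm phi * (e / (rnorm phi + 1)))).
  by rewrite ler_wpM2l ?rnorm_ge0// ltW.
by rewrite mulrA ler_pdivrMr// mulrC ler_wpM2l ?lerDl// ltW.
Qed.

(* Pulling a derivation of [A i] back along the coordinate map gives one of the
   sum; restricting an implementing functional to the i-th summand costs the
   norm of the embedding. *)
Lemma WAM_summand_le i (w : R) : (WAM S < w%:E)%E ->
  (WAM (A i) <= (chi_norm [set i] * w)%:E)%E.
Proof.
move=> Sw; have w0 : 0 <= w.
  by rewrite -lee_fin ltW// (le_lt_trans _ Sw)// WAM_ge0.
have chi0 : 0 <= chi_norm [set i] by exact: rnorm_ge0.
apply: WAM_le => [|D dD]; first by rewrite mulr_ge0.
have D0 : 0 <= opnorm D by apply: opnorm_ge0; case: dD.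
have [D' [dD' D'le D'E]] : exists D' : S -> dual S,
    [/\ bounded_derivation D', opnorm D' <= opnorm D &
        forall a x, D' a x = D (a i) (x i)].
  apply: mk_derivation => // [k a b x|k a x y|a x|a b x].
  - by rewrite Esum_addE Esum_scaleE derivation_lin.
  - by rewrite Esum_addE Esum_scaleE dual_lin.
  - apply: le_trans (form_le _ _ dD) _.
    by rewrite ler_wpM2l// ler_pM ?rnorm_ge0// rnorm_Esum_coord.
  - by rewrite Esum_mulE derivationM.
have [phi [phiE phile]] := WAM_lt Sw dD'.
have [|||psi psile psiE] := @mk_dual _ _ (fun u : A i => phi (Esum_inj u))
    (chi_norm [set i] * (w * opnorm D)).
- by rewrite !mulr_ge0.
- by move=> k u v; rewrite Esum_inj_lin; exact: dual_lin.
- move=> u; apply: le_trans (dual_le _ _) _; rewrite mulrC mulrAC.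
  apply: ler_pM; rewrite ?rnorm_ge0//; first by rewrite mulrC rnorm_Esum_inj.
  by apply: le_trans phile _; rewrite ler_wpM2l.
exists psi; split; last by rewrite -mulrA.
apply: eq_adP => u v; rewrite !psiE !Esum_injM.
(* At embedded elements the pulled-back derivation [D'] returns the values of [D]. *)
by rewrite -{1}[u]Esum_injE -{1}[v]Esum_injE -D'E phiE.
Qed.

End Esum_embeddings.

(** * Restricting a derivation of the sum to the summands *)

Lemma complex_phase (R : realType) (z : R[i]) :
  exists c : R[i], rnorm c = 1 /\ c * z = (rnorm z)%:C.
Proof.
have [->|z0] := eqVneq z 0.
  by exists 1; rewrite mulr0 rnorm0 /rnorm normr1.
have rz0 : rnorm z != 0 by apply: contra_neq z0; exact: rnorm0_eq0.
exists ((rnorm z)%:C / z); rewrite divfK//; split=> //; apply: (mulIf rz0).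
by rewrite -rnormM divfK// rnorm_real mul1r ger0_norm// rnorm_ge0.
Qed.

(** [opnorm D] is a supremum of suprema that need not be attained, hence the loss [e]. *)
Lemma opnorm_form_approx (R : realType) (A : banachAlgType R[i])
    (D : A -> dual A) (e : R) : 0 < e ->
  exists a x, [/\ rnorm a <= 1, rnorm x <= 1 & opnorm D - e <= rnorm (D a x)].
Proof.
move=> e0; apply: contrapT => h.
suff : opnorm D <= opnorm D - e by rewrite leNgt gtrBl e0.
apply: opnorm_le => a a1; apply: opnorm_le => x x1.
rewrite leNgt; apply/negP => lt_; apply: h; exists a, x; split=> //.
exact: ltW.
Qed.

Section Esum_derivations.
Context (R : realType) (I : choiceType) (E : bsl R I) (A : I -> banachAlgType R[i]).
Local Notation S := (Esum E A).
Context (D : S -> dual S) (dD : bounded_derivation D).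

Let D0 : 0 <= opnorm D. Proof. by apply: opnorm_ge0; case: dD. Qed.

(* The functional [u |-> D (inj u) (inj v)] kills products, so its square is a
   derivation of [A i]; that derivation being inner, the functional vanishes. *)
Lemma derivation_cross i j (u : A i) (v : A j) : weakly_amenable (A i) ->
  i != j -> D (Esum_inj E u) (Esum_inj E v) = 0.
Proof.
move=> wAi ij.
have [lD _ _] := dD.
have [|||f _ fE] := @mk_dual _ _ (fun u : A i => D (Esum_inj E u) (Esum_inj E v))
    (opnorm D * chi_norm E [set i] * rnorm (Esum_inj E v)).
- by rewrite !mulr_ge0 ?rnorm_ge0.
- by move=> k x y; rewrite Esum_inj_lin; exact: derivation_lin.
- move=> x; apply: le_trans (form_le _ _ dD) _; rewrite -!mulrA ler_wpM2l//.
  rewrite [leLHS]mulrC [leRHS]mulrCA ler_wpM2l ?rnorm_ge0// mulrC.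
  exact: rnorm_Esum_inj.
(* Elements of distinct summands multiply to zero, so both terms of the Leibniz rule vanish. *)
have fM x y : f (x ** y) = 0.
  rewrite fE Esum_injM derivationM// (Esum_inj_mul0 _ _ _ ij).
  by rewrite Esum_inj_mul0 1?eq_sym// !linear0 addr0.
have [F [dF _ FE]] : exists F : A i -> dual (A i), [/\ bounded_derivation F,
    opnorm F <= rnorm f * rnorm f & forall x y, F x y = f x * f y].
  apply: mk_derivation => [|k x y z|k x y z|x y|x y z].
  - by rewrite mulr_ge0 ?rnorm_ge0.
  - by rewrite dual_lin mulrDl mulrA.
  - by rewrite dual_lin mulrDr mulrCA.
  - by rewrite rnormM mulrACA ler_pM ?rnorm_ge0 ?dual_le.
  - by rewrite !fM mul0r !mulr0 addr0.
(* An inner derivation vanishes on the diagonal, so [f u * f u] is zero. *)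
have [phi phiE] := wAi F dF; apply/eqP; rewrite -fE -[_ == 0]orbb -mulf_eq0.
by rewrite -FE phiE adE subrr.
Qed.

(** The embedding is a bounded homomorphism, so [D] pulls back along it in both arguments. *)
Lemma summand_derivation i : exists Di : A i -> dual (A i),
  bounded_derivation Di /\
  forall u v, Di u v = D (Esum_inj E u) (Esum_inj E v).
Proof.
pose c := chi_norm E [set i].
have [|||||Di [dDi _ DiE]] := @mk_derivation _ (A i)
    (fun u v => D (Esum_inj E u) (Esum_inj E v)) (opnorm D * (c * c)).
- by rewrite !mulr_ge0 ?rnorm_ge0.
- by move=> k u v x; rewrite Esum_inj_lin derivation_lin.
- by move=> k u v x; rewrite Esum_inj_lin dual_lin.
- move=> u v; apply: le_trans (form_le _ _ dD) _; rewrite -mulrA ler_wpM2l//.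
  rewrite [leRHS]mulrACA.
  by apply: ler_pM; rewrite ?rnorm_ge0// mulrC rnorm_Esum_inj.
- by move=> u v x; rewrite !Esum_injM derivationM.
by exists Di.
Qed.

Context (C : R)
  (chiC : forall F : set I, finite_set F -> chi_norm E F <= C).

Lemma rnorm_Esum_inj_sum (s : seq I) (f : forall i, A i) : uniq s ->
  (forall i, rnorm (f i) <= 1) -> rnorm (\sum_(i <- s) Esum_inj E (f i)) <= C.
Proof.
move=> us f1; rewrite -[C]mul1r.
apply: le_trans (ler_wpM2l ler01 (chiC (finite_seq s))).
apply: Esum_norm_le_chi => //.
  by move=> i /negP; rewrite Esum_inj_sumE// => /negPf ->.
by move=> i /= si; rewrite Esum_inj_sumE// si.
Qed.

Context (wA : forall i, weakly_amenable (A i)) (Di : forall i, A i -> dual (A i)).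
Context (DiE : forall i (u v : A i), Di u v = D (Esum_inj E u) (Esum_inj E v)).

Lemma sum_opnorm_summands (s : seq I) : uniq s ->
  \sum_(i <- s) opnorm (@Di i) <= C ^+ 2 * opnorm D.
Proof.
move=> us; apply/ler_addgt0Pr => e e0.
(* The errors [d], one for each entry of [s], add up to at most [e]; the successor keeps the divisor
   nonzero when [s] is empty. *)
pose d := e / (size s).+1%:R; have d0 : 0 < d by rewrite divr_gt0.
have ax i : {p : A i * A i | [/\ rnorm p.1 <= 1, rnorm p.2 <= 1 &
    opnorm (@Di i) - d <= rnorm (Di p.1 p.2)]}.
  apply: cid; have [u [v uv]] := opnorm_form_approx (@Di i) d0.
  by exists (u, v).
pose a i := (sval (ax i)).1; pose x i := (sval (ax i)).2.
have xP i : [/\ rnorm (a i) <= 1, rnorm (x i) <= 1 &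
    opnorm (@Di i) - d <= rnorm (Di (a i) (x i))] by exact: svalP (ax i).
have /choice[c cP] i := complex_phase (D (Esum_inj E (a i)) (Esum_inj E (x i))).
pose sa : S := \sum_(i <- s) Esum_inj E (a i).
pose sx : S := \sum_(i <- s) Esum_inj E (c i *: x i).
(* Cross terms vanish, and the phases [c i] turn the diagonal terms into their moduli. *)
have Dsax : D sa sx = (\sum_(i <- s) rnorm (Di (a i) (x i)))%:C.
  rewrite derivation_sum// rmorph_sum/= !big_seq; apply: eq_bigr => i si.
  rewrite linear_sum (bigD1_seq i)//= big1 ?addr0 => [|j ji].
    have [_] := cP i; rewrite DiE => <-.
    by rewrite Esum_injZ linearZ.
  by rewrite derivation_cross// eq_sym.
have : rnorm (D sa sx) <= C ^+ 2 * opnorm D.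
  (* Each of the two test elements has norm at most [C], whence the square. *)
  apply: le_trans (form_le _ _ dD) _; rewrite mulrC ler_wpM2r// expr2.
  rewrite ler_pM ?rnorm_ge0// rnorm_Esum_inj_sum// => i; have [a1 x1 _] := xP i => //.
  by rewrite rnormZ; have [-> _] := cP i; rewrite mul1r.
rewrite Dsax rnorm_real ger0_norm; last by apply: sumr_ge0 => i _; exact: rnorm_ge0.
rewrite -(lerD2r e); apply: le_trans.
apply: (@le_trans _ _ (\sum_(i <- s) (rnorm (Di (a i) (x i)) + d))).
  by apply: ler_sum => i _; have [_ _] := xP i; rewrite lerBlDr.
rewrite big_split/= lerD2l big_const_seq count_predT iter_addr addr0.
rewrite -mulr_natr /d mulrAC ler_pdivrMr// ler_wpM2l ?(ltW e0)//.
by rewrite ler_nat.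
Qed.

End Esum_derivations.

(** * Gluing the implementing functionals of the summands *)

Definition eventually_seq (I : choiceType) : set_system (seq I) :=
  [set P | exists s : seq I, forall t : seq I, {subset s <= t} -> P t].

(** Sequences compared by inclusion of their entries stand for the finite subsets of [I];
    concatenation is union. *)
Lemma eventually_seq_filter (I : choiceType) : ProperFilter (@eventually_seq I).
Proof.
split; first by move=> [s /(_ s)]; apply.
split=> [|P Q [s sP] [t tQ]|P Q PQ [s sP]].
- by exists [::].
- exists (s ++ t) => r str; split.
    by apply: sP => i si; apply: str; rewrite mem_cat si.
  by apply: tQ => i ti; apply: str; rewrite mem_cat ti orbT.
- by exists s => t /sP; exact: PQ.
Qed.

Section Esum_upper_bound.
Context (R : realType) (I : choiceType) (E : bsl R I) (A : I -> banachAlgType R[i]).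
Local Notation S := (Esum E A).
Context (C : R) (C0 : 0 <= C)
  (chiC : forall F : set I, finite_set F -> chi_norm E F <= C).

(* The restrictions [D_i] of a derivation to the summands have summable norms;
   an implementing functional is the weak-star limit of the finite sums of
   functionals implementing the [D_i]. *)
Lemma Esum_inner_le (w : R) (D : S -> dual S) : 0 <= w ->
  (forall i, (WAM (A i) < w%:E)%E) -> bounded_derivation D ->
  inner_le D (C ^+ 2 * w * opnorm D).
Proof.
move=> w0 Aw dD.
have wA i : weakly_amenable (A i).
  by apply: WAM_lty_weakly_amenable; apply: lt_trans (Aw i) (ltry _).
have D0 : 0 <= opnorm D by apply: opnorm_ge0; case: dD.
pose Di i := sval (cid (summand_derivation dD i)).
have dDi i : bounded_derivation (Di i).
  by have [] := svalP (cid (summand_derivation dD i)).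
have DiE i (u v : A i) : Di i u v = D (Esum_inj E u) (Esum_inj E v).
  by have [_] := svalP (cid (summand_derivation dD i)); apply.
pose phi i := sval (cid (WAM_lt (Aw i) (dDi i))).
have phiE i : Di i = ad (phi i) by have [] := svalP (cid (WAM_lt (Aw i) (dDi i))).
have phile i : rnorm (phi i) <= w * opnorm (Di i).
  by have [] := svalP (cid (WAM_lt (Aw i) (dDi i))).
have K0 : 0 <= C ^+ 2 * w * opnorm D by rewrite !mulr_ge0 ?exprn_ge0.
have psi_ex (s : seq I) : exists psi : dual S,
    rnorm psi <= C ^+ 2 * w * opnorm D /\
    forall i (u : A i), i \in s -> psi (Esum_inj E u) = phi i u.
  (* [undup] makes each index contribute its functional exactly once. *)
  have [|||psi psile psiE] := @mk_dual _ _
      (fun a : S => \sum_(i <- undup s) phi i (a i)) (C ^+ 2 * w * opnorm D).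
  - exact: K0.
  - move=> k a b; rewrite scaler_sumr -big_split; apply: eq_bigr => i _.
    by rewrite Esum_addE Esum_scaleE dual_lin.
  - move=> a; apply: (@le_trans _ _ (\sum_(i <- undup s) (w * opnorm (Di i)) * rnorm a)).
      elim: (undup s) => [|i r IHr]; first by rewrite !big_nil rnorm0.
      rewrite !big_cons; apply: le_trans (rnormD _ _) _; apply: lerD => //.
      apply: le_trans (dual_le _ _) _; apply: ler_pM; rewrite ?rnorm_ge0//.
      exact: rnorm_Esum_coord.
    rewrite -mulr_suml ler_wpM2r ?rnorm_ge0// -mulr_sumr mulrAC [leRHS]mulrC.
    rewrite ler_wpM2l//.
    by apply: sum_opnorm_summands => //; exact: undup_uniq.
  exists psi; split=> // i u si; rewrite psiE (bigD1_seq i) ?mem_undup ?undup_uniq//.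
  rewrite Esum_injE big1 => [|j ji]; first exact: addr0.
  by rewrite Esum_inj_out 1?eq_sym// linear0.
have /choice[psi psiP] := psi_ex.
have FI := eventually_seq_filter I.
have [U [UU UF]] := ultraFilterLemma FI.
have [|chi chile chiE] := @dual_ultralimit _ _ _ U _ psi _ K0.
  by move=> s; have [] := psiP s.
have chi_inj i (u : A i) : chi (Esum_inj E u) = phi i u.
  rewrite -(cvg_lim (@norm_hausdorff _ R[i]^o) (chiE (Esum_inj E u))).
  apply: (cvg_lim (@norm_hausdorff _ R[i]^o)).
  (* As soon as [s] contains [i], the value of [psi s] at the embedded [u] is [phi i u]. *)
  apply: cvgC_rnormP => e e0; apply: UF; exists [:: i] => s si.
  have [_ ->] := psiP s; last by apply: si; rewrite inE.
  by rewrite subrr rnorm0 ltW.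
exists chi; split=> //; apply: eq_adP => a x.
(* Within a summand both sides are given by [phi i]; across distinct summands both are zero. *)
have injs i j (u : A i) (v : A j) :
    D (Esum_inj E u) (Esum_inj E v) = ad chi (Esum_inj E u) (Esum_inj E v).
  rewrite adE; have [ij|ij] := eqVneq i j.
    case: j / ij v => v.
    by rewrite -DiE -!Esum_injM !chi_inj phiE.
  have ji : j != i by rewrite eq_sym.
  by rewrite derivation_cross// !Esum_inj_mul0// dual0 subrr.
(* Density of the finite sums removes the restriction on the second argument. *)
have inj1 i (u : A i) : D (Esum_inj E u) = ad chi (Esum_inj E u).
  apply/eqP; rewrite -subr_eq0; apply/eqP; apply: dual_Esum_eq0 => j v.
  by rewrite -[LHS]/(D _ _ - ad chi _ _) injs subrr.
(* The same density argument in the first argument, for the difference [F] with [x] fixed. *)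
have [F [dF _ FE]] := bounded_derivation_comb 1 (-1) dD (ad_derivation chi).
have [|||f _ fE] := @mk_dual _ _ (fun a : S => F a x) (opnorm F * rnorm x).
- by rewrite mulr_ge0 ?rnorm_ge0// opnorm_ge0//; case: dF.
- by move=> k b c; exact: derivation_lin.
- by move=> b; rewrite -mulrA [rnorm x * _]mulrC form_le.
have f0 : f = 0.
  by apply: dual_Esum_eq0 => i u; rewrite fE FE inj1 mul1r mulN1r subrr.
by apply/eqP; rewrite -subr_eq0 -adE -[X in X - _]mul1r -mulN1r -FE -fE f0.
Qed.

End Esum_upper_bound.

(** * The two-sided estimate and the equivalence *)

Section Esum_weak_amenability.
Context (R : realType) (I : choiceType) (E : bsl R I) (A : I -> banachAlgType R[i]).
Local Notation S := (Esum E A).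
Local Notation W := (ereal_sup [set WAM (A i) | i in [set: I]]).

(** [K] is a parameter so as to serve both as [C_E] in general and as [1] when the unit vectors are
    normalized. *)
Lemma sup_WAM_le (K : R) : 0 <= K -> (forall i, chi_norm E [set i] <= K) ->
  (WAM S < +oo)%E -> (W <= K%:E * WAM S)%E.
Proof.
move=> K0 chiK Soo.
have Sfin : WAM S \is a fin_num by rewrite ge0_fin_numE ?WAM_ge0.
rewrite -(fineK Sfin) -EFinM; apply: ge_ereal_sup => _ [i _ <-].
apply/lee_addgt0Pr => e e0; have K1 : 0 < K + 1 by rewrite ltr_wpDl.
(* The infimum need not be attained; [K] times the slack [e / (K + 1)] is at most [e]. *)
have Sw : (WAM S < (fine (WAM S) + e / (K + 1))%:E)%E.
  by rewrite EFinD fineK// lteDl// lte_fin divr_gt0.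
apply: le_trans (WAM_summand_le i Sw) _; rewrite -EFinD lee_fin.
have w0 : 0 <= fine (WAM S) + e / (K + 1).
  by rewrite addr_ge0 ?divr_ge0 ?fine_ge0 ?WAM_ge0 ?(ltW e0) ?(ltW K1).
apply: le_trans (ler_wpM2r w0 (chiK i)) _; rewrite mulrDr lerD2l.
by rewrite mulrA ler_pdivrMr// mulrC ler_wpM2l ?lerDl// ltW.
Qed.

Lemma WAM_Esum_le (C : R) : 0 <= C ->
  (forall F : set I, finite_set F -> chi_norm E F <= C) ->
  (0 <= W < +oo)%E -> (WAM S <= (C ^+ 2)%:E * W)%E.
Proof.
move=> C0 chiC /andP[W0 Woo].
have Wfin : W \is a fin_num by rewrite ge0_fin_numE.
rewrite -(fineK Wfin) -EFinM; set x := fine W.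
have x0 : 0 <= x by rewrite fine_ge0.
apply/lee_addgt0Pr => e e0.
have C1 : 0 < C ^+ 2 + 1 by rewrite ltr_wpDl ?exprn_ge0.
pose w := x + e / (C ^+ 2 + 1).
have w0 : 0 <= w by rewrite addr_ge0// divr_ge0// ltW.
apply: (@le_trans _ _ (C ^+ 2 * w)%:E).
  apply: WAM_le => [|D dD]; first by rewrite mulr_ge0 ?exprn_ge0.
  apply: (Esum_inner_le C0 chiC) => // i.
  apply: (@le_lt_trans _ _ W); first by apply: ereal_sup_ubound; exists i.
  by rewrite -(fineK Wfin) lte_fin ltrDl divr_gt0.
rewrite -EFinD lee_fin mulrDr lerD2l.
by rewrite mulrA ler_pdivrMr// mulrC ler_wpM2l ?lerDl// ltW.
Qed.

Lemma weak_amenability_Esum : [set: I] !=set0 -> (bsl_C E < +oo)%E ->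
  [/\ weakly_amenable S <-> (W < +oo)%E,
      (W < +oo -> (bsl_C E)^-1 * W <= WAM S <= bsl_C E ^+ 2 * W)%E &
      (W < +oo)%E -> (forall i : I, rnorm (bsl_of E \1_[set i]) = 1) ->
        (W <= WAM S)%E].
Proof.
move=> [i0 _] Eoo.
(* The index [i0] matters: an empty supremum would be [-oo]. *)
have W0 : (0 <= W)%E.
  apply: le_trans (WAM_ge0 (A i0)) _; apply: ereal_sup_ubound.
  by exists i0.
have E1 : (1 <= bsl_C E)%E.
  apply: le_trans (chi_norm_le E (finite_set1 i0)).
  by rewrite lee_fin chi_norm_ge1.
have Efin : bsl_C E \is a fin_num by rewrite ge0_fin_numE// (le_trans _ E1).
pose C := fine (bsl_C E); have CE : bsl_C E = C%:E by rewrite fineK.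
have C1 : 1 <= C by rewrite -lee_fin -CE.
have C0 : 0 < C by rewrite (lt_le_trans _ C1).
have chiC F : finite_set F -> chi_norm E F <= C.
  by move=> finF; rewrite -lee_fin -CE; exact: chi_norm_le.
have chi1 i : chi_norm E [set i] <= C by exact: chiC (finite_set1 i).
have lower := sup_WAM_le (ltW C0) chi1.
have upper : (W < +oo)%E -> (WAM S <= (C ^+ 2)%:E * W)%E.
  by move=> Woo; apply: (WAM_Esum_le (ltW C0) chiC); rewrite W0.
have SW : (W < +oo)%E -> (WAM S < +oo)%E.
  move=> Woo; apply: le_lt_trans (upper Woo) _.
  have Wfin : W \is a fin_num by rewrite ge0_fin_numE.
  by rewrite -(fineK Wfin) -EFinM ltry.
split.
- split=> [wS|Woo]; last exact/WAM_lty_weakly_amenable/SW.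
  (* Weak amenability of the sum first yields a finite constant, to which the lower estimate
     applies. *)
  have Soo := weakly_amenable_WAM_lty wS; apply: le_lt_trans (lower Soo) _.
  have Sfin : WAM S \is a fin_num by rewrite ge0_fin_numE ?WAM_ge0.
  by rewrite -(fineK Sfin) -EFinM ltry.
- move=> Woo; rewrite CE -EFin_expe upper// andbT inver gt_eqF//.
  have := lower (SW Woo).
  have Wfin : W \is a fin_num by rewrite ge0_fin_numE.
  have Sfin : WAM S \is a fin_num by rewrite ge0_fin_numE ?WAM_ge0// SW.
  rewrite -(fineK Wfin) -(fineK Sfin) -!EFinM !lee_fin.
  by rewrite ler_pdivrMl.
- move=> Woo chi_eq1; rewrite -[leRHS]mul1e.
  by apply: sup_WAM_le (SW Woo) => // i; rewrite /chi_norm chi_eq1.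
Qed.

End Esum_weak_amenability.

(** * Orlicz hearts whose function vanishes near zero *)

Lemma orlicz_heart_bsl_C (R : realType) (I : choiceType) (phi : orlicz R)
    (c : {posnum R}) (h : forall (f : heart I phi c) (i : I), `|f i| <= `|f|) :
  0 < orlicz_a phi -> (bsl_C (orlicz_heart h) < +oo)%E.
Proof.
move=> a0.
(* A positive supremum of the zeros of [phi] forces a positive zero. *)
have [t [t0 phit]] : exists t, 0 < t /\ phi t = 0.
  apply: contrapT => nt; suff : orlicz_a phi <= 0 by rewrite leNgt a0.
  apply: ge_sup; first by exists 0; split=> //; exact: orlicz0.
  move=> t /= [t0 phit]; rewrite leNgt; apply/negP => tgt0.
  by apply: nt; exists t.
apply: (@le_lt_trans _ _ (c%:num * t^-1)%:E); last exact: ltry.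
apply: ge_ereal_sup => _ [F finF <-]; rewrite lee_fin.
set g : heart I phi c := bsl_of (orlicz_heart h) \1_F.
have gE i : g i = \1_F i := bsl_of_indicE (orlicz_heart h) i finF.
rewrite -lecR rnormE heart_normE lecR ler_wpM2l//.
(* Divided by [t^-1], an indicator takes only the values [0] and [t], where [phi] vanishes; the
   bound is thus independent of [F]. *)
have lux_le : (lux phi g <= t^-1%:E)%E.
  apply: ereal_inf_lbound; exists t^-1 => //; split; first by rewrite invr_gt0.
  rewrite esum1// => i _; rewrite gE invrK indicE.
  case: (i \in F); last by rewrite rnorm0 mul0r orlicz0.
  by rewrite (_ : rnorm _ = 1) ?mul1r ?phit// /rnorm normr1.
rewrite -lee_fin fineK// ge0_fin_numE ?lux_ge0//.
exact: le_lt_trans lux_le (ltry _).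
Qed.

Local Open Scope ereal_scope.

Theorem corollary7p9 (R : realType) (I : choiceType)
    (I_neq0 : [set: I] !=set0) (A : I -> banachAlgType R[i]) :
  let W := ereal_sup [set WAM (A i) | i in [set: I]] in
  (forall E : bsl R I, bsl_C E < +oo ->
    [/\ weakly_amenable (Esum E A) <-> W < +oo,
        W < +oo -> (bsl_C E)^-1 * W <= WAM (Esum E A) <= bsl_C E ^+ 2 * W
      & W < +oo -> (forall i : I, rnorm (bsl_of E \1_[set i]) = 1%R) ->
          W <= WAM (Esum E A)]) /\
  (forall (phi : orlicz R) (c : {posnum R})
      (h : forall (f : heart I phi c) (i : I), (`|f i| <= `|f|)%R),
    (0 < orlicz_a phi)%R ->
    bsl_C (orlicz_heart h) < +oo /\
    (weakly_amenable (Esum (orlicz_heart h) A) <-> W < +oo)).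
Proof.
split=> [E|phi c h a0]; first exact: weak_amenability_Esum.
have Coo := orlicz_heart_bsl_C h a0; split=> //.
by have [] := weak_amenability_Esum A I_neq0 Coo.
Qed.
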